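(* Let $f:M\to M$ be a $C^1$ map such that $\inf_{x\in M}\|Df(x)\|>0$ and let $K\subset M$ be a compact $f$-invariant subset such that $\chi^-(x)<0$ for all $x\in K$. Then $K$ is the union of a finite family of sinks (attracting periodic orbits) of $f$.
   Context: $M$ is a connected compact $d$-dimensional manifold, $d\ge 2$, endowed with a Riemannian metric inducing a norm $\|\cdot\|$ on the tangent bundle (and operator norms) and a distance $\operatorname{dist}$ on $M$. $K$ is $f$-invariant if $f(K)=K$. Here $\chi^-(x)=\liminf_{n\to+\infty}\frac1n\ln\|Df^n(x)\|$ (with $\ln0=-\infty$). A point $p$ belongs to a periodic orbit (with period $\tau$) if $f^\tau p=p$ for some $\tau\in\mathbb{Z}^+$ (not required to be minimal). The periodic orbit $\{p,fp,\dots,f^{\tau-1}p\}$ is attracting (a sink) if there is a neighborhood $V_p$ of $p$ such that $f^\tau|_{V_p}:V_p\to V_p$ is a contraction (there is $0<\lambda<1$ with $\operatorname{dist}(f^\tau q,f^\tau r)<\lambda\operatorname{dist}(q,r)$ for all distinct $q,r\in V_p$; equivalently $\|Df^\tau(p)\|<\lambda$ for some $\lambda\in(0,1)$). *)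

(* Defs.v *)
From HB Require Import structures.
From mathcomp Require Import all_boot all_order all_algebra.
From mathcomp Require Import all_classical all_reals all_analysis.

Set Implicit Arguments.
Unset Strict Implicit.
Unset Printing Implicit Defensive.

Import Order.TTheory GRing.Theory Num.Theory.
Import numFieldNormedType.Exports.

Local Open Scope classical_set_scope.
Local Open Scope ring_scope.

(* To be used on an open set U; for finite-dimensional V this is the usual
   notion, all iterated directional derivatives up to order k being
   continuous on U. *)
Fixpoint is_Ck (R : realType) (V W : normedModType R) (k : nat)
    (U : set V) (f : V -> W) : Prop :=
  if k is k'.+1 then
    (forall x, U x -> differentiable f x) /\
    (forall v, is_Ck k' U (fun x => 'd f x v))
  else {in U, continuous f}.

Definition smooth_on (R : realType) (V W : normedModType R)
    (U : set V) (f : V -> W) : Prop := forall k, is_Ck k U f.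

(* chart_map and chart_inv are total functions; their values outside
   chart_dom and its image are irrelevant. *)
Record chart (R : realType) (d : nat) (M : topologicalType) := Chart {
  chart_dom : set M ;
  chart_map :> M -> 'rV[R]_d ;
  chart_inv : 'rV[R]_d -> M ;
  chart_dom_open : open chart_dom ;
  chart_codom_open : open (chart_map @` chart_dom) ;
  chart_map_continuous : {in chart_dom, continuous chart_map} ;
  chart_inv_continuous :
    {in chart_map @` chart_dom, continuous chart_inv} ;
  chart_mapK : {in chart_dom, cancel chart_map chart_inv} }.

Definition chart_codom (R : realType) (d : nat) (M : topologicalType)
    (c : chart R d M) : set 'rV[R]_d := c @` chart_dom c.

(* A smooth atlas with a preferred chart at each point.  The tangent space at
   x is identified with 'rV[R]_d through the chart [chart_at x]. *)
Record smooth_structure (R : realType) (d : nat) (M : topologicalType) :=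
  SmoothStructure {
  atlas : set (chart R d M) ;
  chart_at : M -> chart R d M ;
  chart_at_atlas : forall x, atlas (chart_at x) ;
  chart_at_dom : forall x, chart_dom (chart_at x) x ;
  atlas_compatible : forall c c', atlas c -> atlas c' ->
    smooth_on (chart_codom c `&` chart_inv c @^-1` chart_dom c')
      (c' \o chart_inv c) }.

Definition bilin (R : realType) (d : nat) (G : 'M[R]_d) (u v : 'rV[R]_d) : R :=
  (u *m G *m v^T) 0 0.

(* [metric_mx x] is the Gram matrix at x in the coordinates of [chart_at x].
   Smoothness is that of the components of the metric in every chart c: at y
   the coordinate vector u of c is carried to the coordinates of
   [chart_at (chart_inv c y)] by the differential of the change of charts. *)
Record riemannian_metric (R : realType) (d : nat) (M : topologicalType)
    (A : smooth_structure R d M) := RiemannianMetric {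
  metric_mx : M -> 'M[R]_d ;
  metric_sym : forall x, (metric_mx x)^T = metric_mx x ;
  metric_pos : forall x u, u != 0 -> 0 < bilin (metric_mx x) u u ;
  metric_smooth : forall c, atlas A c -> forall u v : 'rV[R]_d,
    smooth_on (V := 'rV[R]_d) (W := R^o) (chart_codom c)
      (fun y => let x := chart_inv c y in
        bilin (metric_mx x) ('d (chart_at A x \o chart_inv c) y u)
                            ('d (chart_at A x \o chart_inv c) y v)) }.

Section riemannian.
Context {R : realType} {d : nat} {M : topologicalType}.
Context {A : smooth_structure R d M} (g : riemannian_metric A).

Definition tnorm (x : M) (v : 'rV[R]_d) : R :=
  Num.sqrt (bilin (metric_mx g x) v v).

Definition curve_velocity (gamma : R -> M) (t : R) : 'rV[R]_d :=
  derive1 (chart_at A (gamma t) \o gamma) t.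

(* A C^1 curve on a compact interval is the restriction of a C^1 curve
   defined on an open neighbourhood of that interval. *)
Definition C1_arc (gamma : R -> M) : Prop :=
  exists I : set R, [/\ open I, `[0, 1] `<=` I, {in I, continuous gamma} &
    forall c, atlas A c ->
      is_Ck (V := R^o) (W := 'rV[R]_d) 1
        (I `&` gamma @^-1` chart_dom c) (c \o gamma)].

Definition arc_length (gamma : R -> M) : R :=
  \int[lebesgue_measure]_(t in `[0, 1])
    tnorm (gamma t) (curve_velocity gamma t).

(* A piecewise C^1 curve from x to y of length L is a finite concatenation
   of C^1 arcs of total length L. *)
Inductive joined : M -> M -> R -> Prop :=
| joined_refl x : joined x x 0
| joined_arc gamma z L : C1_arc gamma -> joined (gamma 1) z L ->
    joined (gamma 0) z (arc_length gamma + L).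

Definition dist (x y : M) : R := inf [set L | joined x y L].

End riemannian.

Section maps.
Context {R : realType} {d : nat} {M : topologicalType}.
Context (A : smooth_structure R d M).

Definition C1_map (f : M -> M) : Prop :=
  continuous f /\
  forall c c', atlas A c -> atlas A c' ->
    is_Ck 1 (chart_codom c `&` (f \o chart_inv c) @^-1` chart_dom c')
      (c' \o f \o chart_inv c).

Definition tangent_map (f : M -> M) (x : M) (v : 'rV[R]_d) : 'rV[R]_d :=
  'd (chart_at A (f x) \o f \o chart_inv (chart_at A x)) (chart_at A x x) v.

End maps.

Section dynamics.
Context {R : realType} {d : nat} {M : topologicalType}.
Context {A : smooth_structure R d M} (g : riemannian_metric A).

Definition opnorm (f : M -> M) (x : M) : R :=
  sup [set tnorm g (f x) (tangent_map A f x v) | v in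
        [set v | tnorm g x v <= 1]].

Definition chi_minus (f : M -> M) (x : M) : \bar R :=
  limn_einf (fun n => (n%:R^-1)%:E * lne (opnorm (iter n f) x)%:E)%E.

Definition is_sink (f : M -> M) (O : set M) : Prop :=
  exists (p : M) (tau : nat),
    [/\ (0 < tau)%N, iter tau f p = p,
        O = [set iter i f p | i in `I_tau] &
        exists2 V : set M, nbhs p V &
          (iter tau f @` V `<=` V /\
           exists lambda : R, [/\ 0 < lambda, lambda < 1 &
             forall q r, V q -> V r -> q <> r ->
               dist g (iter tau f q) (iter tau f r) < lambda * dist g q r])].

End dynamics.

(* Main.v *)
From HB Require Import structures.
From mathcomp Require Import finmap.
Require Import Defs.
From mathcomp Require Import all_boot all_order all_algebra.
From mathcomp Require Import all_classical all_reals all_analysis.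
From mathcomp Require Import ring lra zify.

(** Since [chi_minus] is negative on K, each x in K has an iterate f^n, n > 0,
    with [opnorm (f^n) x < 1] ([chi_minus_lt0]).  The differential of a C^1 map
    is continuous, so f^n shortens by a factor less than 1 all short curves that
    start near x ([lip_at_opnorm]).  By compactness of K the exponent n is bounded
    and the factor is uniform.  Cutting an orbit of K into such contracting
    blocks yields one N such that f^N at least halves the length of every short
    curve that starts near a point of K ([uniform_contraction]).

    This forces K to be finite ([finite_of_contraction]).  Cover K by m sets in
    each of which any two points are joined by a curve shorter than rho.  Given
    m + 1 points of K, pull them back by f^(N k), which maps K onto K.  Two of the
    preimages lie in the same set, so two of the given points are joined by a curve
    shorter than rho / 2^k.  As k is arbitrary and distinct points are not joined
    by arbitrarily short curves, the m + 1 points are not distinct.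

    A map of a finite set onto itself permutes it, so every point of K is periodic
    under f^N, and the contraction makes its orbit a sink ([sink_through_point]).
    The orbits of the points of K form a finite family with union K.

    The estimates are made on the relation [joined x y L], that is on curves and
    their lengths, and distances appear only in the definition of a sink.  The link
    with the topology of M is local: nearby points are joined by short curves
    ([near_joined]), and short curves stay near their origin ([joined_near]).
    Both follow from the comparison, in one chart, of the Riemannian norm with
    the norm of the coordinates ([chart_norm_bounds]); the second also uses that M
    is Hausdorff, through a first-exit argument ([arc_confined]). *)

Set Implicit Arguments.
Unset Strict Implicit.
Unset Printing Implicit Defensive.

Import Order.TTheory GRing.Theory Num.Theory.
Import numFieldNormedType.Exports.

Local Open Scope classical_set_scope.
Local Open Scope ring_scope.

(** * Continuously differentiable maps between normed spaces *)

Section C1.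
Context {R : realType}.
Implicit Types (U V W : normedModType R).

(** Two maps with the same germ at x differ by a map that vanishes near x,
    which is negligible; they therefore have the same first-order expansion. *)
Lemma near_eq_diff V W (f h : V -> W) (x : V) :
  (\near x, f x = h x) -> differentiable f x ->
  differentiable h x /\ 'd h x = 'd f x :> (V -> W).
Proof.
move=> fh df.
have hd : h \o shift x = cst (h x) + 'd f x +o_ 0 id.
  apply/eqaddoP => e e0.
  have /eqaddoP/(_ e e0) := diff_locally df.
  have : \forall y \near (0 : V), f (y + x) = h (y + x).
    by have := fh; rewrite (near_shift 0 x) subr0.
  apply: filterS2 => y /= fhy.
  by rewrite /cst /= !fctE /= fhy (nbhs_singleton fh).
have E : 'd h x = 'd f x :> (V -> W).
  by apply: diff_unique => //; exact: diff_continuous.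
split=> //; apply/diff_locallyP; rewrite E; split=> //.
exact: diff_continuous.
Qed.

Lemma near_eq_diff_comp U V W (f : U -> V) (h : V -> W) (k : U -> W) x v :
  (\forall y \near x, (h \o f) y = k y) -> differentiable f x ->
  differentiable h (f x) -> 'd k x v = 'd h (f x) ('d f x v).
Proof.
move=> E df dh.
have [_ e] := near_eq_diff E (differentiable_comp df dh).
by rewrite e (diff_comp df dh).
Qed.

Lemma near_id_diff V (k : V -> V) x v :
  (\forall y \near x, y = k y) -> 'd k x v = v.
Proof.
have did : differentiable (@id V) x by [].
move=> E; have [_ ->] := near_eq_diff E did.
by rewrite diff_val.
Qed.

(** Only the directional derivatives are required to be continuous, as in
    [is_Ck]; on a finite-dimensional space this amounts to joint continuity of
    the differential, see [C1_at_diff_joint]. *)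
Definition C1_at V W (f : V -> W) (x : V) : Prop :=
  (\forall y \near x, differentiable f y) /\
  forall v, {for x, continuous (fun y => 'd f y v)}.

Lemma C1_at_diff V W (f : V -> W) x : C1_at f x -> differentiable f x.
Proof. by move=> [+ _] => /nbhs_singleton. Qed.

Lemma C1_at_cont V W (f : V -> W) x : C1_at f x -> {for x, continuous f}.
Proof. by move=> /C1_at_diff /differentiable_continuous. Qed.

Lemma C1_at_ext V W (f h : V -> W) x :
  (\near x, f x = h x) -> C1_at f x -> C1_at h x.
Proof.
move=> fh [df cf].
have E : \forall y \near x, differentiable h y /\ 'd h y = 'd f y :> (V -> W).
  near=> y; apply: near_eq_diff; last exact: (near df y).
  by near: y; exact: nbhs_interior.
split; first by apply: filterS E => y [].
move=> v; rewrite /prop_for /continuous_at.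
rewrite (nbhs_singleton E).2; apply: cvg_trans (cf v).
by apply: near_eq_cvg; apply: filterS E => y [_ ->].
Unshelve. all: by end_near. Qed.

Lemma Ck1_C1_at V W (D : set V) (f : V -> W) x :
  open D -> is_Ck 1 D f -> D x -> C1_at f x.
Proof.
move=> oD [/= df cf] Dx; split; last by move=> v; apply: cf; rewrite inE.
by apply: filterS (open_nbhs_nbhs (conj oD Dx)).
Qed.

Lemma C1_at_Ck1 V W (D : set V) (f : V -> W) :
  (forall x, D x -> C1_at f x) -> is_Ck 1 D f.
Proof.
move=> h; split=> [x /h/C1_at_diff//|v x /set_mem Dx]; exact: (h _ Dx).2.
Qed.

(** Expanding the vector in a finite family with continuous coordinates turns
    the differential into a finite sum of products of a coordinate and a
    directional derivative along a fixed vector. *)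
Lemma C1_at_diff_joint_basis V W n (e : 'I_n -> V) (co : 'I_n -> V -> R)
    (f : V -> W) (x v : V) :
  (forall i, continuous (co i)) -> (forall w, w = \sum_i co i w *: e i) ->
  C1_at f x ->
  (fun p : V * V => 'd f (p.1) p.2) @ (x, v) --> 'd f x v.
Proof.
move=> cco spane [_ cf].
have E y w : 'd f y w = \sum_i co i w *: 'd f y (e i).
  rewrite [in LHS](spane w) linear_sum; apply: eq_bigr => i _.
  by rewrite linearZ.
rewrite (E x v).
have -> : (fun p : V * V => 'd f (p.1) p.2) =
    (fun p => \sum_i co i p.2 *: 'd f (p.1) (e i)).
  by apply/funext => p; exact: E.
apply: cvg_big => [|i _]; first exact: add_continuous.
apply: cvgZ.
  apply: (@cvg_comp _ _ _ (fun p : V * V => p.2) (co i) _ (nbhs v)).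
    exact: cvg_snd.
  exact: cco.
apply: (@cvg_comp _ _ _ (fun p : V * V => p.1)
   (fun y => 'd f y (e i)) _ (nbhs x)); first exact: cvg_fst.
exact: cf.
Qed.

Lemma linear_row_sum W d (f : {linear 'rV[R]_d -> W}) (u : 'rV[R]_d) :
  f u = \sum_i u 0 i *: f (delta_mx 0 i).
Proof.
rewrite {1}[u]row_sum_delta linear_sum; apply: eq_bigr => i _.
by rewrite linearZ.
Qed.

Lemma C1_at_diff_joint W d (f : 'rV[R]_d -> W) (x v : 'rV[R]_d) : C1_at f x ->
  (fun p : 'rV[R]_d * 'rV[R]_d => 'd f (p.1) p.2) @ (x, v) --> 'd f x v.
Proof.
apply: (@C1_at_diff_joint_basis _ _ d (delta_mx 0) (fun i w => w 0 i)).
- by move=> i; exact: coord_continuous.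
- exact: row_sum_delta.
Qed.

Lemma C1_at_comp_joint U V W (f : U -> V) (h : V -> W) x :
  (forall v, (fun p : V * V => 'd h (p.1) p.2) @ (f x, v) --> 'd h (f x) v) ->
  C1_at f x -> C1_at h (f x) -> C1_at (h \o f) x.
Proof.
move=> Jh Cf Ch; have [df cf] := Cf; have [dh ch] := Ch.
have nh : \forall y \near x, differentiable h (f y).
  have c0 : f @ x --> f x := C1_at_cont Cf.
  exact: (c0 _ dh).
split; first by apply: filterS2 df nh => y; exact: differentiable_comp.
move=> v; rewrite /prop_for /continuous_at.
have E : \forall y \near x, 'd h (f y) ('d f y v) = 'd (h \o f) y v.
  near=> y.
  have dfy : differentiable f y by near: y.
  have dhy : differentiable h (f y) by near: y.
  by rewrite (diff_comp dfy dhy).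
rewrite -(nbhs_singleton E).
apply: cvg_trans; first by apply: near_eq_cvg; exact: E.
apply: (@cvg_comp _ _ _ (fun y => (f y, 'd f y v))
   (fun p : V * V => 'd h (p.1) p.2) _
   (nbhs (f x, 'd f x v))); last exact: Jh.
have c0 : f @ x --> f x := C1_at_cont Cf.
have c1 : 'd f y v @[y --> x] --> 'd f x v := cf v.
exact: cvg_pair.
Unshelve. all: by end_near. Qed.

Lemma C1_at_comp V W d (f : V -> 'rV[R]_d) (h : 'rV[R]_d -> W) x :
  C1_at f x -> C1_at h (f x) -> C1_at (h \o f) x.
Proof.
move=> Cf Ch; apply: C1_at_comp_joint => // v; exact: C1_at_diff_joint.
Qed.
End C1.

(** * Charts and continuously differentiable maps of the manifold *)

Section charts.
Context {R : realType} {d : nat} {M : topologicalType}.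
Implicit Types (c : chart R d M) (x : M) (y : 'rV[R]_d).

Lemma codom_chart c x : chart_dom c x -> chart_codom c (c x).
Proof. by move=> cx; exists x. Qed.

Lemma chart_invK c y : chart_codom c y -> c (chart_inv c y) = y.
Proof. by move=> [x cx <-]; rewrite chart_mapK ?inE. Qed.

Lemma chart_inv_dom c y : chart_codom c y -> chart_dom c (chart_inv c y).
Proof. by move=> [x cx <-]; rewrite chart_mapK ?inE. Qed.

Lemma chart_K c x : chart_dom c x -> chart_inv c (c x) = x.
Proof. by move=> cx; rewrite chart_mapK ?inE. Qed.

Lemma chart_cvg c x : chart_dom c x -> c @ x --> c x.
Proof. by move=> cx; apply: chart_map_continuous; rewrite inE. Qed.

Lemma chart_inv_cvg c y : chart_codom c y -> chart_inv c @ y --> chart_inv c y.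
Proof. by move=> cy; apply: chart_inv_continuous; rewrite inE. Qed.

Lemma near_dom c x : chart_dom c x -> nbhs x (chart_dom c).
Proof.
by move=> cx; apply: open_nbhs_nbhs; split=> //; exact: chart_dom_open.
Qed.

Lemma near_codom c y : chart_codom c y -> nbhs y (chart_codom c).
Proof.
by move=> cy; apply: open_nbhs_nbhs; split=> //; exact: chart_codom_open.
Qed.

Lemma open_chart_preimage (T : topologicalType) (D : set T) (h : T -> M) c :
  open D -> (forall t, D t -> h @ t --> h t) ->
  open (D `&` h @^-1` chart_dom c).
Proof.
move=> oD hc; rewrite openE => t [Dt ct]; apply: filterI.
  exact: open_nbhs_nbhs.
exact: (hc _ Dt _ (near_dom ct)).
Qed.
End charts.

Section C1_maps.
Context {R : realType} {d : nat} {M : topologicalType}.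
Context (A : smooth_structure R d M).
Implicit Types (c : chart R d M).

(** The source is a normed space, so that the same notion serves for curves,
    whose source is the line, and for maps of M read in a chart of the source. *)
Definition C1_into (V : normedModType R) (h : V -> M) (t : V) : Prop :=
  h @ t --> h t /\
  forall c, atlas A c -> chart_dom c (h t) -> C1_at (c \o h) t.

Lemma C1_into_chart_inv c y :
  atlas A c -> chart_codom c y -> C1_into (chart_inv c) y.
Proof.
move=> Ac cy; split; first exact: chart_inv_cvg.
move=> c' Ac' c'y.
apply: (Ck1_C1_at _ (atlas_compatible Ac Ac' 1%N)); last by [].
apply: (@open_chart_preimage _ _ _ 'rV[R]_d); first exact: chart_codom_open.
by move=> z cz; apply: chart_inv_cvg.
Qed.

Lemma near_transition (V : normedModType R) (h : V -> M) t c c' :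
  h @ t --> h t -> chart_dom c (h t) ->
  \forall s \near t, ((c' \o chart_inv c) \o (c \o h)) s = (c' \o h) s.
Proof.
move=> ht ct.
have nd : \forall s \near t, chart_dom c (h s) := ht _ (near_dom ct).
apply: filterS nd => s /= cs.
by rewrite chart_K.
Qed.

(** Changes of charts are continuously differentiable, so one chart around
    the image point decides for all of them. *)
Lemma C1_into_one_chart (V : normedModType R) (h : V -> M) t c :
  h @ t --> h t -> atlas A c -> chart_dom c (h t) -> C1_at (c \o h) t ->
  C1_into h t.
Proof.
move=> ht Ac ct Ch; split; first exact: ht.
move=> c' Ac' c't.
apply: C1_at_ext (near_transition c' ht ct) _.
have Cc : C1_at (c' \o chart_inv c) (c (h t)).
  apply: (C1_into_chart_inv Ac (codom_chart ct)).2 => //.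
  by rewrite chart_K.
exact: C1_at_comp Ch Cc.
Qed.

Lemma diff_transition (V : normedModType R) (h : V -> M) t c c' v :
  C1_into h t -> atlas A c -> atlas A c' -> chart_dom c (h t) ->
  chart_dom c' (h t) ->
  'd (c' \o h) t v = 'd (c' \o chart_inv c) (c (h t)) ('d (c \o h) t v).
Proof.
move=> [ht Ch] Ac Ac' ct c't.
have d1 : differentiable (c \o h) t by apply: C1_at_diff; exact: Ch.
have d2 : differentiable (c' \o chart_inv c) ((c \o h) t).
  apply: C1_at_diff; apply: (C1_into_chart_inv Ac (codom_chart ct)).2 => //.
  by rewrite chart_K.
exact: near_eq_diff_comp (near_transition c' ht ct) d1 d2.
Qed.

(** Unlike [C1_map], this form is visibly stable under composition: the chart
    of the target stays inside [C1_into]. *)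
Definition C1_self (F : M -> M) : Prop := continuous F /\
  forall c y, atlas A c -> chart_codom c y -> C1_into (F \o chart_inv c) y.

Lemma C1_map_self F : C1_map A F -> C1_self F.
Proof.
move=> [cF CF]; split=> // c y Ac cy.
have cFc z : chart_codom c z -> F \o chart_inv c @ z --> (F \o chart_inv c) z.
  by move=> cz; apply: continuous_comp; [exact: chart_inv_cvg|exact: cF].
split; first exact: cFc.
move=> c' Ac' c'y.
apply: (Ck1_C1_at _ (CF _ _ Ac Ac')); last by [].
apply: (@open_chart_preimage _ _ _ 'rV[R]_d); last exact: cFc.
exact: chart_codom_open.
Qed.

Lemma C1_into_comp (V : normedModType R) F (h : V -> M) t :
  C1_self F -> C1_into h t -> C1_into (F \o h) t.
Proof.
move=> [cF CF] [ht Ch]; set c := chart_at A (h t).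
have Ac : atlas A c by exact: chart_at_atlas.
have ct : chart_dom c (h t) by exact: chart_at_dom.
have cy := codom_chart ct.
split; first exact: (continuous_comp ht (cF _)).
move=> c' Ac' c't.
apply: (@C1_at_ext _ _ _ ((c' \o (F \o chart_inv c)) \o (c \o h))).
  have nd : \forall s \near t, chart_dom c (h s) := ht _ (near_dom ct).
  apply: filterS nd => s /= cs.
  by rewrite chart_K.
have CFc : C1_at (c' \o (F \o chart_inv c)) (c (h t)).
  by apply: (CF c _ Ac cy).2 => //; rewrite /= chart_K.
exact: C1_at_comp (Ch _ Ac ct) CFc.
Qed.

Lemma C1_self_iter F n : C1_self F -> C1_self (iter n F).
Proof.
move=> CF; elim: n => [|n [cn Cn]]; split.
- by move=> x; exact: cvg_id.
- by move=> c y; exact: C1_into_chart_inv.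
- move=> x; apply: (@continuous_comp _ _ _ (iter n F) F); first exact: cn.
  exact: CF.1.
- move=> c y Ac cy; apply: (C1_into_comp CF (h := iter n F \o chart_inv c)).
  exact: Cn.
Qed.
End C1_maps.

(** * The metric read in a chart *)

Section chart_norm.
Context {R : realType} {d : nat} {M : topologicalType}.
Context {A : smooth_structure R d M} (g : riemannian_metric A).
Implicit Types (c : chart R d M) (y u v w : 'rV[R]_d).

(** The quantity whose smoothness in y is part of the definition of a
    Riemannian metric. *)
Definition chart_gram c y u v : R :=
  let x := chart_inv c y in
  bilin (metric_mx g x) ('d (chart_at A x \o chart_inv c) y u)
                        ('d (chart_at A x \o chart_inv c) y v).

(** The norm of the tangent vector that has coordinates u in the chart c, at
    the point of coordinates y.  The preferred charts [chart_at] need not depend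
    continuously on the point, so neither does [tnorm] for fixed coordinates;
    read in one fixed chart the norm is continuous. *)
Definition chart_norm c y u : R :=
  tnorm g (chart_inv c y)
    ('d (chart_at A (chart_inv c y) \o chart_inv c) y u).

Lemma bilin_suml (G : 'M[R]_d) (I : finType) (a : I -> R)
    (e : I -> 'rV[R]_d) w :
  bilin G (\sum_i a i *: e i) w = \sum_i a i * bilin G (e i) w.
Proof.
rewrite /bilin !mulmx_suml summxE; apply: eq_bigr => i _.
by rewrite -!scalemxAl mxE.
Qed.

Lemma bilin_sumr (G : 'M[R]_d) (I : finType) (a : I -> R)
    (e : I -> 'rV[R]_d) w :
  bilin G w (\sum_i a i *: e i) = \sum_i a i * bilin G w (e i).
Proof.
rewrite /bilin linear_sum /= mulmx_sumr summxE; apply: eq_bigr => i _.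
by rewrite linearZ /= -!scalemxAr mxE.
Qed.

Lemma bilinZ (G : 'M[R]_d) a u :
  bilin G (a *: u) (a *: u) = a ^+ 2 * bilin G u u.
Proof.
by rewrite /bilin linearZ /= -!scalemxAl -scalemxAr scalerA mxE expr2.
Qed.

Lemma tnormZ x a u : tnorm g x (a *: u) = `|a| * tnorm g x u.
Proof. by rewrite /tnorm bilinZ sqrtrM ?sqr_ge0// sqrtr_sqr. Qed.

Lemma tnorm_ge0 x u : 0 <= tnorm g x u. Proof. exact: sqrtr_ge0. Qed.

Lemma chart_normZ c y a u : chart_norm c y (a *: u) = `|a| * chart_norm c y u.
Proof. by rewrite /chart_norm linearZ tnormZ. Qed.

Lemma chart_norm0 c y : chart_norm c y 0 = 0.
Proof. by have := chart_normZ c y 0 0; rewrite scale0r normr0 mul0r. Qed.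

Lemma chart_norm_sqrt c y u : chart_norm c y u =
  Num.sqrt (\sum_i \sum_j
    u 0 i * (u 0 j * chart_gram c y (delta_mx 0 i) (delta_mx 0 j))).
Proof.
rewrite /chart_norm /tnorm; congr Num.sqrt.
rewrite [in LHS](linear_row_sum _ u) bilin_suml; apply: eq_bigr => i _.
by rewrite bilin_sumr mulr_sumr.
Qed.

(** The square of the norm is a polynomial in the coordinates of u and the
    components of the metric, all of them continuous. *)
Lemma chart_norm_cvg c y u : atlas A c -> chart_codom c y ->
  (fun p : 'rV[R]_d * 'rV[R]_d => chart_norm c p.1 p.2) @ (y, u) -->
  chart_norm c y u.
Proof.
move=> Ac cy.
have cb v w : chart_gram c z v w @[z --> y] --> chart_gram c y v w.
  by have := metric_smooth g Ac v w 0%N; apply; rewrite inE.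
have -> : (fun p : 'rV[R]_d * 'rV[R]_d => chart_norm c p.1 p.2) =
  (@Num.sqrt R) \o (fun p : 'rV[R]_d * 'rV[R]_d => \sum_i \sum_j p.2 0 i *
    (p.2 0 j * chart_gram c p.1 (delta_mx 0 i) (delta_mx 0 j))).
  by apply/funext => p; exact: chart_norm_sqrt.
rewrite chart_norm_sqrt.
have cco i : (fun p : 'rV[R]_d * 'rV[R]_d => p.2 0 i) @ (y, u) --> u 0 i.
  apply: (@cvg_comp _ _ _ (fun p : 'rV[R]_d * 'rV[R]_d => p.2)
     (fun w : 'rV[R]_d => w 0 i) _ (nbhs u)); first exact: cvg_snd.
  exact: coord_continuous.
apply: (@cvg_comp _ _ _ _ Num.sqrt); last exact: sqrt_continuous.
apply: cvg_big => [|i _]; first exact: add_continuous.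
apply: cvg_big => [|j _]; first exact: add_continuous.
apply: cvgM; first exact: cco.
apply: cvgM; first exact: cco.
apply: (@cvg_comp _ _ _ (fun p : 'rV[R]_d * 'rV[R]_d => p.1)
   (fun z => chart_gram c z (delta_mx 0 i) (delta_mx 0 j)) _ (nbhs y));
  last exact: cb.
exact: cvg_fst.
Qed.

(** A change of charts has an injective differential, since the opposite
    change of charts inverts it. *)
Lemma chart_norm_gt0 c y u : atlas A c -> chart_codom c y -> u != 0 ->
  0 < chart_norm c y u.
Proof.
move=> Ac cy u0; rewrite /chart_norm /tnorm sqrtr_gt0; apply: metric_pos.
set x := chart_inv c y; set c1 := chart_at A x.
apply: contra_neq u0 => Lu0.
have c1x : chart_dom c1 x by exact: chart_at_dom.
have cx : chart_dom c x by exact: chart_inv_dom.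
have <- : 'd (c \o chart_inv c) y u = u.
  apply: near_id_diff.
  by have := near_codom cy; apply: filterS => z cz /=; rewrite chart_invK.
have E := diff_transition u (C1_into_chart_inv Ac cy) (chart_at_atlas A x) Ac
  c1x cx.
apply: (etrans E).
exact: (etrans (congr1 ('d (c \o chart_inv c1) (c1 x)) Lu0) (linear0 _)).
Qed.

(** Both sides are the norm of the velocity: by the chain rule the change from
    c to the preferred chart carries one coordinate vector to the other. *)
Lemma chart_norm_speed (gamma : R -> M) (t : R) c :
  C1_into A (V := R^o) gamma t -> atlas A c -> chart_dom c (gamma t) ->
  tnorm g (gamma t) (curve_velocity (A := A) gamma t) =
  chart_norm c (c (gamma t)) ('d ((c \o gamma) : R^o -> 'rV[R]_d) t 1).
Proof.
move=> Cg Ac ct; rewrite /chart_norm chart_K // /curve_velocity.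
set c1 := chart_at A (gamma t).
have Ac1 : atlas A c1 := chart_at_atlas A (gamma t).
have c1t : chart_dom c1 (gamma t) := chart_at_dom A (gamma t).
have d1 : differentiable ((c1 \o gamma) : R^o -> 'rV[R]_d) t.
  exact: C1_at_diff (Cg.2 _ Ac1 c1t).
rewrite (derive1E' d1); congr (tnorm g _ _).
exact: (diff_transition (V := R^o) 1 Cg Ac Ac1 ct c1t).
Qed.
End chart_norm.

Section sphere.
Context {R : realType} {d : nat}.

Definition sphere : set 'rV[R]_d := [set u | `|u| = 1].

Lemma compact_sphere : compact sphere.
Proof.
apply: bounded_closed_compact.
  exists 1; split=> [|r r1 u /= ->]; [exact: num_real|exact: ltW].
apply: (@closed_comp _ _ (fun u : 'rV[R]_d => `|u|) [set 1]).
  by move=> u _; exact: norm_continuous.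
exact: closed_eq.
Qed.

(** The tube lemma: the strict inequality is an open condition, and the sphere
    is compact. *)
Lemma sphere_near (Phi : 'rV[R]_d -> 'rV[R]_d -> R) (y : 'rV[R]_d) k :
  (forall u, sphere u -> Phi p.1 p.2 @[p --> (y, u)] --> Phi y u) ->
  (forall u, sphere u -> Phi y u < k) ->
  \forall z \near y, forall u, sphere u -> Phi z u < k.
Proof.
move=> cPhi Phik.
have /compact_near_coveringP cov := compact_sphere.
apply: (cov _ (nbhs y) (fun z u => Phi z u < k)) => u Su.
have := cPhi u Su _ (lt_nbhsl (Phik u Su)).
move=> [[/= Y U] [Yy Uu] YU]; exists (U, Y) => //= -[u' z] /= [Uu' Yz].
exact: (YU (z, u')).
Qed.

Lemma sphere_bounded (phi : 'rV[R]_d -> R) :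
  (forall u, sphere u -> phi @ u --> phi u) ->
  exists2 k, 0 < k & forall u, sphere u -> phi u < k.
Proof.
move=> cphi; have /compact_near_coveringP cov := compact_sphere.
have : \forall k \near \oo, sphere `<=` (fun u => phi u < k%:R).
  apply: (cov _ \oo (fun k u => phi u < k%:R)) => u Su.
  have lt1 : phi u < phi u + 1 by rewrite ltrDl.
  have n1 : \forall u' \near u, phi u' < phi u + 1 :=
    cphi u Su _ (lt_nbhsl lt1).
  have n2 : \forall k \near \oo, phi u + 1 < k%:R :> R.
    exact: nbhs_infty_gtr.
  exists ([set u' | phi u' < phi u + 1], [set k | phi u + 1 < k%:R]) => //=.
  by move=> -[u' k] /= [h1 h2]; exact: lt_trans h2.
move=> [N _ hN]; exists N.+1%:R; first by rewrite ltr0n.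
by move=> u Su; apply: (hN N.+1) => //=.
Qed.

Lemma rV_normalize (u : 'rV[R]_d) : u != 0 -> sphere (`|u|^-1 *: u).
Proof.
by move=> u0; rewrite /sphere /= normrZ normfV normr_id mulVf// normr_eq0.
Qed.

Lemma coord_le_norm (u : 'rV[R]_d) i : `|u 0 i| <= `|u|.
Proof.
rewrite [leRHS]/Num.norm /= mx_normrE.
by apply: (@le_bigmax _ _ _ 0 (fun ij => `|u ij.1 ij.2|) (0, i)).
Qed.

Lemma norm_le_coord (u : 'rV[R]_d) k : 0 <= k ->
  (forall i, `|u 0 i| <= k) -> `|u| <= k.
Proof.
move=> k0 h; rewrite [leLHS]/Num.norm /= mx_normrE; apply/bigmax_leP; split=> //.
by move=> [i j] _ /=; rewrite ord1; exact: h.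
Qed.
End sphere.

Lemma cvg_pair_slice (T U : topologicalType) (t : T) (u : U) :
  (fun u' => (t, u')) @ u --> (t, u).
Proof. by apply: cvg_pair; [exact: cvg_cst|exact: cvg_id]. Qed.

Section chart_bounds.
Context {R : realType} {d : nat} {M : topologicalType}.
Context {A : smooth_structure R d M} (g : riemannian_metric A).

(** On the unit sphere the norm and its inverse are continuous, hence bounded,
    uniformly for y near y0; homogeneity extends the bounds to all vectors. *)
Lemma chart_norm_bounds (c : chart R d M) y0 : atlas A c -> chart_codom c y0 ->
  exists2 C, 0 < C & \forall y \near y0, forall u : 'rV[R]_d,
    chart_norm g c y u <= C * `|u| /\ `|u| <= C * chart_norm g c y u.
Proof.
move=> Ac cy0.
have cn (u : 'rV[R]_d) :
    chart_norm g c p.1 p.2 @[p --> (y0, u)] --> chart_norm g c y0 u.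
  exact: chart_norm_cvg.
have slice (Phi : 'rV[R]_d -> 'rV[R]_d -> R) (u : 'rV[R]_d) :
    Phi p.1 p.2 @[p --> (y0, u)] --> Phi y0 u -> Phi y0 @ u --> Phi y0 u.
  move=> cPhi; exact: (cvg_comp _ _ (@cvg_pair_slice _ _ y0 u) cPhi).
have cn' (u : 'rV[R]_d) : sphere u ->
    (chart_norm g c p.1 p.2)^-1 @[p --> (y0, u)] --> (chart_norm g c y0 u)^-1.
  move=> Su; apply: cvgV; last exact: cn.
  rewrite gt_eqF// chart_norm_gt0//.
  by apply: contra_eq_neq Su => ->; rewrite normr0 eq_sym oner_neq0.
have [k1 k10 hk1] :=
  sphere_bounded (fun u _ => slice (chart_norm g c) u (cn u)).
have [k2 k20 hk2] := sphere_bounded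
   (fun u Su => slice (fun y u => (chart_norm g c y u)^-1) u (cn' u Su)).
have N1 := sphere_near (fun u _ => cn u) hk1.
have N2 := sphere_near (Phi := fun y u => (chart_norm g c y u)^-1) cn' hk2.
exists (Num.max k1 k2); first by rewrite lt_max k10.
near=> y; move=> u.
have cy : chart_codom c y by near: y; exact: near_codom.
have [->|u0] := eqVneq u 0.
  by rewrite chart_norm0 normr0 !mulr0.
have Su := rV_normalize u0.
have nu0 : 0 < `|u| by rewrite normr_gt0.
have B1 : chart_norm g c y (`|u|^-1 *: u) < k1 by exact: (near N1 y).
have B2 : (chart_norm g c y (`|u|^-1 *: u))^-1 < k2 by exact: (near N2 y).
have cu0 : 0 < chart_norm g c y u by exact: chart_norm_gt0.
move: B1 B2; rewrite chart_normZ normfV normr_id invfM invrK => B1 B2; split.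
  rewrite mulrC -ler_pdivrMl//; apply: le_trans (ltW B1) _.
  by rewrite le_max lexx.
rewrite -ler_pdivrMr//; apply: le_trans (ltW B2) _.
by rewrite le_max lexx orbT.
Unshelve. all: by end_near. Qed.
End chart_bounds.

(** * The mean value inequality *)

Section mean_value.
Context {R : realType} {d : nat}.

Definition rV_coord (i : 'I_d) (v : 'rV[R]_d) : R^o := v 0 i.

Fact rV_coord_linear i : linear (rV_coord i).
Proof. by move=> a u v; rewrite /rV_coord !mxE. Qed.

HB.instance Definition _ i :=
  GRing.isLinear.Build R 'rV[R]_d R^o _ (rV_coord i) (rV_coord_linear i).

Lemma differentiable_rV_coord i v : differentiable (rV_coord i) v.
Proof. by apply: linear_differentiable; exact: coord_continuous. Qed.

Lemma diff_rV_coord i v w : 'd (rV_coord i) v w = w 0 i.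
Proof. by rewrite diff_lin//; exact: coord_continuous. Qed.

Lemma integrable_within (s : R -> R) (a b : R) :
  {within `[a, b], continuous s} ->
  (@lebesgue_measure R).-integrable `[a, b] (EFin \o s).
Proof.
move=> cs; apply: continuous_compact_integrable => //; exact: segment_compact.
Qed.

(** The norm on row vectors is the maximum of the coordinates, so it suffices
    to integrate the derivative of each coordinate.  The integral on the right
    is over the whole unit interval, whatever the final time T, because only
    the total length of an arc enters the estimates below. *)
Lemma mean_value (u : R^o -> 'rV[R]_d) (s : R -> R) T :
  0 <= T <= 1 -> (forall t, 0 <= t <= T -> C1_at u t) ->
  {within `[0, 1], continuous s} -> (forall t, 0 <= t <= 1 -> 0 <= s t) ->
  (forall t, 0 <= t <= T -> `|'d u t 1| <= s t) ->
  `|u T - u 0| <= \int[lebesgue_measure]_(t in `[0, 1]) s t.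
Proof.
move=> /andP[T0 T1] Cu cs s0 us.
have I0 : 0 <= \int[lebesgue_measure]_(t in `[0, 1]) s t.
  by apply: Rintegral_ge0 => t /=; rewrite in_itv /=; exact: s0.
apply: norm_le_coord => // i.
move: T0; rewrite le_eqVlt => /predU1P[<-|T0].
  by rewrite subrr mxE normr0.
pose F (t : R) : R := rV_coord i (u t).
pose f (t : R) : R := ('d u t 1) 0 i.
have dF t : 0 <= t <= T ->
    differentiable (F : R^o -> R^o) t /\ derive1 F t = f t.
  move=> tT; have du := C1_at_diff (Cu _ tT).
  have dc := differentiable_rV_coord i (u t).
  have dF : differentiable (F : R^o -> R^o) t.
    exact: differentiable_comp du dc.
  split=> //; rewrite (derive1E' dF).
  have -> : 'd (F : R^o -> R^o) t = 'd (rV_coord i) (u t) \o 'd u t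
      :> (R^o -> R^o).
    exact: diff_comp.
  by rewrite /= diff_rV_coord.
have cf : {within `[0, T], continuous f}.
  apply: continuous_in_subspaceT => t /set_mem tT.
  have c1 : 'd u r 1 @[r --> t] --> 'd u t 1 := (Cu _ tT).2 1.
  have c2 : rV_coord i @ ('d u t 1) --> rV_coord i ('d u t 1).
    exact: coord_continuous.
  exact: (cvg_comp _ _ c1 c2).
have cF t : 0 <= t <= T -> F @ t --> F t.
  by move=> tT; exact: differentiable_continuous (dF _ tT).1.
have sub t : t \in `]0, T[ -> 0 <= t <= T.
  by rewrite in_itv /= => /andP[/ltW -> /ltW ->].
have LR : derivable_oo_LRcontinuous F 0 T.
  split.
  - by move=> t tT; apply: diff_derivable; apply: (dF _ _).1; exact: sub.
  - by apply: cvg_at_right_filter; apply: cF; rewrite lexx ltW.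
  - by apply: cvg_at_left_filter; apply: cF; rewrite lexx ltW.
have F'f : {in `]0, T[, derive1 F =1 f}.
  by move=> t tT; apply: (dF _ _).2; exact: sub.
have E := continuous_FTC2 T0 cf LR F'f.
have {}E : F T - F 0 = \int[lebesgue_measure]_(t in `[0, T]) f t.
  by rewrite /Rintegral E.
have -> : (u T - u 0) 0 i = F T - F 0 by rewrite /F /rV_coord !mxE.
have S01 : `[0, T] `<=` `[0, 1 : R].
  by move=> t /=; rewrite !in_itv /= => /andP[-> /le_trans]; apply.
have cs' : {within `[0, T], continuous s} by exact: continuous_subspaceW cs.
have If := integrable_within cf.
have Is := integrable_within cs.
have Is' := integrable_within cs'.
rewrite E; apply: le_trans (le_normr_Rintegral _ If) _ => //.
apply: (@le_trans _ _ (\int[lebesgue_measure]_(t in `[0, T]) s t)).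
  apply: le_Rintegral => //; first exact: integrable_norm If.
  move=> t /=; rewrite in_itv /= => tT; apply: le_trans (us _ tT).
  exact: coord_le_norm.
rewrite /Rintegral; apply: fine_le.
- exact: integrable_fin_num.
- exact: integrable_fin_num.
apply: ge0_subset_integral => //; exact: measurable_int Is.
Qed.
End mean_value.

(** * Arcs, their speed and their length *)

Lemma dist_continuous (R : realType) (V : normedModType R) (y0 : V) :
  continuous (fun y => `|y - y0|).
Proof.
by move=> y; apply: cvg_norm; apply: cvgB; [exact: cvg_id|exact: cvg_cst].
Qed.

Section arcs.
Context {R : realType} {d : nat} {M : topologicalType}.
Context {A : smooth_structure R d M} (g : riemannian_metric A).
Implicit Types (c : chart R d M) (gamma : R -> M) (t : R).

Definition speed gamma t : R :=
  tnorm g (gamma t) (curve_velocity (A := A) gamma t).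

Definition C1_curve_at gamma t : Prop := C1_into A (V := R^o) gamma t.

Lemma C1_arc_intro gamma (I : set R) : open I -> `[0, 1] `<=` I ->
  (forall t, I t -> C1_curve_at gamma t) -> C1_arc (A := A) gamma.
Proof.
move=> oI sI CI; exists I; split=> //.
  by move=> t /set_mem /CI [].
by move=> c Ac; apply: C1_at_Ck1 => t [It ct]; exact: (CI _ It).2.
Qed.

Lemma C1_arc_elim gamma : C1_arc (A := A) gamma -> exists I : set R,
  [/\ open I, `[0, 1] `<=` I & forall t, I t -> C1_curve_at gamma t].
Proof.
move=> [I [oI sI cI CI]]; exists I; split=> // t It.
have ct u : I u -> gamma @ u --> gamma u by move=> Iu; apply: cI; rewrite inE.
split; first exact: ct.
move=> c Ac cgt; apply: (Ck1_C1_at _ (CI c Ac)); last by [].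
exact: open_chart_preimage.
Qed.

Lemma speed_ge0 gamma t : 0 <= speed gamma t.
Proof. exact: tnorm_ge0. Qed.

(** Near each time the speed is the norm, in one chart, of the derivative of
    the curve in that chart. *)
Lemma speed_cvg gamma t : (\forall s \near t, C1_curve_at gamma s) ->
  speed gamma @ t --> speed gamma t.
Proof.
move=> Cg; have Cgt : C1_curve_at gamma t := nbhs_singleton Cg.
set c := chart_at A (gamma t).
have Ac : atlas A c := chart_at_atlas A _.
have ct : chart_dom c (gamma t) := chart_at_dom A _.
have E : \forall s \near t, chart_norm g c (c (gamma s))
    ('d ((c \o gamma) : R^o -> 'rV[R]_d) s 1) = speed gamma s.
  have nd : \forall s \near t, chart_dom c (gamma s) := Cgt.1 _ (near_dom ct).
  apply: filterS2 Cg nd => s Cs cs.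
  by rewrite /speed (chart_norm_speed g Cs Ac cs).
rewrite -(nbhs_singleton E).
apply: cvg_trans; first by apply: near_eq_cvg; exact: E.
have c1 : (c \o gamma) @ t --> c (gamma t) := C1_at_cont (Cgt.2 c Ac ct).
have c2 : 'd ((c \o gamma) : R^o -> 'rV[R]_d) s 1 @[s --> t] -->
  'd ((c \o gamma) : R^o -> 'rV[R]_d) t 1 := (Cgt.2 c Ac ct).2 1.
apply: (@cvg_comp _ _ _
  (fun s => (c (gamma s), 'd ((c \o gamma) : R^o -> 'rV[R]_d) s 1))
  (fun p : 'rV[R]_d * 'rV[R]_d => chart_norm g c p.1 p.2) _
  (nbhs (c (gamma t), 'd ((c \o gamma) : R^o -> 'rV[R]_d) t 1))).
  exact: cvg_pair c1 c2.
exact: chart_norm_cvg Ac (codom_chart ct).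
Qed.

Lemma speed_continuous gamma : C1_arc (A := A) gamma ->
  {within `[0, 1], continuous (speed gamma)}.
Proof.
move=> /C1_arc_elim[I [oI sI CI]].
apply: continuous_in_subspaceT => t /set_mem /sI It; apply: speed_cvg.
by apply: filterS (open_nbhs_nbhs (conj oI It)) => s /CI.
Qed.

Lemma arc_lengthE gamma :
  arc_length g gamma = \int[lebesgue_measure]_(t in `[0, 1]) speed gamma t.
Proof. by []. Qed.

Lemma arc_length_ge0 gamma : 0 <= arc_length g gamma.
Proof. by apply: Rintegral_ge0 => t _; exact: speed_ge0. Qed.

Lemma joined_ge0 x y L : joined g x y L -> 0 <= L.
Proof. by elim=> // gamma z L' _ _ L'0; rewrite addr_ge0// arc_length_ge0. Qed.

Lemma arc_length_le gamma delta k : 0 <= k ->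
  C1_arc (A := A) gamma -> C1_arc (A := A) delta ->
  (forall t, 0 <= t <= 1 -> speed delta t <= k * speed gamma t) ->
  arc_length g delta <= k * arc_length g gamma.
Proof.
move=> k0 Cg Cd le; rewrite !arc_lengthE.
have Ig := integrable_within (speed_continuous Cg).
have Id := integrable_within (speed_continuous Cd).
have <- : \int[lebesgue_measure]_(t in `[0, 1]) (k * speed gamma t) =
    k * \int[lebesgue_measure]_(t in `[0, 1]) speed gamma t.
  by apply: RintegralZl Ig; exact: measurable_itv.
apply: le_Rintegral => //.
exact: (@integrableZl _ _ _ lebesgue_measure `[0, 1] (measurable_itv _) k _ Ig).
Qed.

Lemma C1_arc_comp F gamma : C1_self A F -> C1_arc (A := A) gamma ->
  C1_arc (A := A) (F \o gamma).
Proof.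
move=> CF /C1_arc_elim[I [oI sI CI]]; apply: (C1_arc_intro oI sI) => t It.
by apply: C1_into_comp => //; exact: CI.
Qed.

(** One constant serves both inequalities and all points of the ball, so that
    lengths of curves and displacements in coordinates control each other. *)
Definition tame_ball c (y0 : 'rV[R]_d) (r C : R) : Prop :=
  [/\ atlas A c, 0 < r, 0 < C & forall y, `|y - y0| < r -> chart_codom c y /\
    forall u, chart_norm g c y u <= C * `|u| /\ `|u| <= C * chart_norm g c y u].

Lemma tame_ball_exists c x (Y : set 'rV[R]_d) : atlas A c -> chart_dom c x ->
  nbhs (c x) Y -> exists r C, tame_ball c (c x) r C /\
    forall y, `|y - c x| < r -> Y y.
Proof.
move=> Ac cx YY; have cy := codom_chart cx.
have [C C0 HC] := chart_norm_bounds g Ac cy.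
have N : nbhs (c x) (Y `&` (chart_codom c `&` [set y | forall u,
    chart_norm g c y u <= C * `|u| /\ `|u| <= C * chart_norm g c y u])).
  by apply: filterI => //; apply: filterI => //; exact: near_codom.
have [r /= r0 hr] := (iffLR (nbhs_ballP _ _) N).
exists r, C; have hb y : `|y - c x| < r -> ball (c x) r y.
  by rewrite -ball_normE /= distrC.
split; last by move=> y /hb /hr [].
split=> // y /hb /hr [_ [cy' H]]; split=> // u; exact: H.
Qed.

Lemma compact_rV_ball (y0 : 'rV[R]_d) r :
  compact [set y : 'rV[R]_d | `|y - y0| <= r].
Proof.
apply: bounded_closed_compact.
  exists (`|y0| + r); split; first exact: num_real.
  move=> k kr y /= yr; apply/ltW/(le_lt_trans _ kr).
  by rewrite -[y](subrK y0) (le_trans (ler_normD _ _))// addrC lerD.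
apply: (@closed_comp _ _ (fun y : 'rV[R]_d => `|y - y0|) [set t | t <= r]).
  by move=> y _; exact: dist_continuous.
exact: closed_le.
Qed.
End arcs.

(** * Short curves in a chart ball *)

Section confinement.
Context {R : realType} {d : nat} {M : topologicalType}.
Context {A : smooth_structure R d M} (g : riemannian_metric A).
Context (hM : hausdorff_space M).
Implicit Types (c : chart R d M) (gamma : R -> M) (t : R).

Definition chart_ball c (y0 : 'rV[R]_d) (r : R) (x : M) : Prop :=
  chart_dom c x /\ `|c x - y0| < r.

Lemma near_chart_ball c y0 r x : chart_ball c y0 r x ->
  nbhs x (chart_ball c y0 r).
Proof.
move=> [cx xr]; apply: filterI; first exact: near_dom.
have cd := @dist_continuous _ 'rV[R]_d y0 (c x).
exact: (cvg_comp _ _ (chart_cvg cx) cd _ (lt_nbhsl xr)).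
Qed.

(** Inside the ball the coordinate velocity is at most C times the speed. *)
Lemma confined_arc_displacement c y0 r C gamma T : tame_ball g c y0 r C ->
  C1_arc (A := A) gamma -> 0 <= T <= 1 ->
  (forall t, 0 <= t <= T -> chart_ball c y0 r (gamma t)) ->
  `|c (gamma T) - c (gamma 0)| <= C * arc_length g gamma.
Proof.
move=> [Ac r0 C0 tm] Cg T01 conf.
have cs : {within `[0, 1], continuous (speed g gamma)}.
  exact: speed_continuous.
have Ig := integrable_within cs.
have <- : \int[lebesgue_measure]_(t in `[0, 1]) (C * speed g gamma t) =
    C * arc_length g gamma.
  by apply: RintegralZl Ig; exact: measurable_itv.
have [I [oI sI CI]] := C1_arc_elim Cg.
have TI t : 0 <= t <= T -> I t.
  move=> /andP[t0 tT]; apply: sI; rewrite /= in_itv /= t0 /=.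
  by case/andP: T01 => _; exact: le_trans.
apply: (@mean_value _ _ ((c \o gamma) : R^o -> 'rV[R]_d) _ T) => //.
- by move=> t tT; apply: (CI _ (TI _ tT)).2 => //; exact: (conf _ tT).1.
- by move=> t; exact: (cvg_comp _ _ (cs t) (@mulrl_continuous R C _)).
- by move=> t _; rewrite mulr_ge0// ?speed_ge0// ltW.
- move=> t tT; have [cd cr] := conf _ tT.
  have := (tm _ cr).2 ('d ((c \o gamma) : R^o -> 'rV[R]_d) t 1).
  by move=> [_]; rewrite /speed (chart_norm_speed g (CI _ (TI _ tT)) Ac cd).
Qed.

(** A first-exit argument.  Let t0 be the infimum of the times at which the
    arc is outside the ball.  Before t0 the displacement estimate holds, so the
    arc stays in the closed ball of radius r1 < r.  This closed ball is compact,
    hence closed in the Hausdorff space M and contains the point at time t0.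
    But then the arc remains in the open ball for some time after t0. *)
Lemma arc_confined c y0 r C gamma : tame_ball g c y0 r C ->
  C1_arc (A := A) gamma -> chart_dom c (gamma 0) ->
  `|c (gamma 0) - y0| + C * arc_length g gamma < r ->
  forall t, 0 <= t <= 1 -> chart_ball c y0 r (gamma t).
Proof.
move=> tm Cg cg0 lr; have [Ac r0 C0 tmh] := tm.
have l0 : 0 <= C * arc_length g gamma by rewrite mulr_ge0 ?arc_length_ge0// ltW.
have conf0 : chart_ball c y0 r (gamma 0).
  by split=> //; apply: le_lt_trans lr; rewrite lerDl.
apply: contrapT => /existsNP[t1 /not_implyP[t1I nt1]].
pose bad := [set t | 0 <= t <= 1 /\ ~ chart_ball c y0 r (gamma t)].
have badn : bad !=set0 by exists t1.
have lb0 : lbound bad 0 by move=> t [/andP[]].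
have hlb : has_lbound bad by exists 0.
pose t0 := inf bad.
have t00 : 0 <= t0 by exact: lb_le_inf.
have t0t1 : t0 <= t1 by exact: ge_inf.
have t01 : t0 <= 1 by apply: le_trans t0t1 _; case/andP: t1I.
have before s : 0 <= s -> s < t0 -> chart_ball c y0 r (gamma s).
  move=> s0 st0; apply: contrapT => ns.
  suff : t0 <= s by rewrite leNgt st0.
  by apply: ge_inf => //; split=> //; rewrite s0 (le_trans (ltW st0)).
have [I [oI sI CI]] := C1_arc_elim Cg.
have cg0t : gamma @ t0 --> gamma t0.
  by apply: (CI _ _).1; apply: sI; rewrite /= in_itv /= t00.
suff good0 : chart_ball c y0 r (gamma t0).
  have /nbhs_ballP[e /= e0 he] : \forall s \near t0,
    chart_ball c y0 r (gamma s) := cg0t _ (near_chart_ball good0).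
  have [b [bI nb] bt0] : exists2 b, bad b & b < t0 + e.
    by apply: inf_lt => //; rewrite ltrDl.
  have t0b : t0 <= b by apply: ge_inf.
  apply: nb; apply: he; rewrite /ball /= distrC ger0_norm.
    by rewrite ltrBlDl.
  by rewrite subr_ge0.
move: t00; rewrite le_eqVlt => /predU1P[<-//|t00].
pose r1 := `|c (gamma 0) - y0| + C * arc_length g gamma.
pose K1 := [set y : 'rV[R]_d | `|y - y0| <= r1].
have K1c y : K1 y -> chart_codom c y.
  by move=> /le_lt_trans /(_ lr) /tmh [].
have cK : closed (chart_inv c @` K1).
  apply: compact_closed => //; apply: continuous_compact.
    by apply: continuous_in_subspaceT => y /set_mem /K1c; exact: chart_inv_cvg.
  exact: compact_rV_ball.
have [y K1y yg] : (chart_inv c @` K1) (gamma t0).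
  apply: cK => B /cg0t /nbhs_ballP[e /= e0 he].
  pose s := Num.max 0 (t0 - e / 2).
  have s0 : 0 <= s by rewrite le_max lexx.
  have st0 : s < t0 by rewrite gt_max t00 ltrBlDr ltrDl divr_gt0.
  exists (gamma s); split; last first.
    apply: he; rewrite /ball /= ger0_norm ?subr_ge0 ?(ltW st0)//.
    rewrite ltrBlDr -ltrBlDl lt_max; apply/orP; right.
    by rewrite ltrD2l ltrN2 ltr_pdivrMr// ltr_pMr// ltr1n.
  have [cs sr] := before s s0 st0.
  exists (c (gamma s)); last by rewrite chart_K.
  have s01 : 0 <= s <= 1 by rewrite s0 (le_trans (ltW st0)).
  have := @confined_arc_displacement c y0 r C gamma s tm Cg s01.
  move=> h; rewrite /K1 /r1 /= [leRHS]addrC.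
  rewrite -[c (gamma s)](subrK (c (gamma 0))) -addrA.
  apply: (le_trans (ler_normD _ _)); rewrite lerD2r; apply: h.
  by move=> u /andP[u0 us]; apply: before => //; exact: (le_lt_trans us st0).
have cy := K1c _ K1y.
rewrite -yg; split; first exact: chart_inv_dom.
rewrite chart_invK //; exact: (le_lt_trans K1y lr).
Qed.

Lemma arc_end_confined c y0 r C gamma : tame_ball g c y0 r C ->
  C1_arc (A := A) gamma -> chart_dom c (gamma 0) ->
  `|c (gamma 0) - y0| + C * arc_length g gamma < r ->
  chart_dom c (gamma 1) /\
  `|c (gamma 1) - c (gamma 0)| <= C * arc_length g gamma.
Proof.
move=> tm Cg cg0 lr; have conf := arc_confined tm Cg cg0 lr.
split; first by have [] := conf 1; rewrite ?ler01 ?lexx.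
by apply: (confined_arc_displacement tm) => //; rewrite ler01 lexx.
Qed.

Lemma joined_confined c y0 r C x z L : tame_ball g c y0 r C ->
  joined g x z L -> chart_dom c x -> `|c x - y0| + C * L < r ->
  chart_dom c z /\ `|c z - c x| <= C * L.
Proof.
move=> tm; elim=> {x z L} [x cx _|gamma z L Cg jL IH cg0 lr].
  by rewrite subrr normr0 mulr0.
have [_ _ C0 _] := tm.
have L0 := joined_ge0 jL; have l0 := arc_length_ge0 g gamma.
have CL0 : 0 <= C * L by rewrite mulr_ge0// ltW.
rewrite mulrDr in lr *.
have lr1 : `|c (gamma 0) - y0| + C * arc_length g gamma < r.
  by apply: le_lt_trans lr; rewrite addrA lerDl.
have [cg1 g1] := arc_end_confined tm Cg cg0 lr1.
have [|cz zL] := IH cg1.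
  apply: le_lt_trans lr; rewrite addrA lerD2r.
  rewrite -[c (gamma 1)](subrK (c (gamma 0))) -addrA addrC.
  by rewrite (le_trans (ler_normD _ _))// lerD2l.
split=> //; rewrite -[c z](subrK (c (gamma 1))) -addrA addrC.
by rewrite (le_trans (ler_normD _ _))// addrC lerD// addrC.
Qed.

(** If F multiplies the norms of tangent vectors by at most k on a chart ball,
    it does the same with the lengths of the arcs inside that ball, and a short
    curve that starts well inside the ball does not leave it. *)
Lemma joined_image c y0 r C F c' k x z L : tame_ball g c y0 r C -> 0 <= k ->
  C1_self A F -> atlas A c' ->
  (forall y, `|y - y0| < r -> chart_dom c' (F (chart_inv c y)) /\
     forall u, chart_norm g c' (c' (F (chart_inv c y)))
        ('d (c' \o F \o chart_inv c) y u) <= k * chart_norm g c y u) ->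
  joined g x z L -> chart_dom c x -> `|c x - y0| + C * L < r ->
  exists2 L', joined g (F x) (F z) L' & L' <= k * L.
Proof.
move=> tm k0 CF Ac' contr; elim=> {x z L} [x cx _|gamma z L Cg jL IH cg0 lr].
  by exists 0; [exact: joined_refl|rewrite mulr0].
have [Ac _ C0 tmh] := tm.
have L0 := joined_ge0 jL; have l0 := arc_length_ge0 g gamma.
have CL0 : 0 <= C * L by rewrite mulr_ge0// ltW.
rewrite mulrDr in lr.
have lr1 : `|c (gamma 0) - y0| + C * arc_length g gamma < r.
  by apply: le_lt_trans lr; rewrite addrA lerDl.
have [cg1 g1] := arc_end_confined tm Cg cg0 lr1.
have conf := arc_confined tm Cg cg0 lr1.
have [|L' jL' L'k] := IH cg1.
  apply: le_lt_trans lr; rewrite addrA lerD2r.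
  rewrite -[c (gamma 1)](subrK (c (gamma 0))) -addrA addrC.
  by rewrite (le_trans (ler_normD _ _))// lerD2l.
have CFg := C1_arc_comp CF Cg.
exists (arc_length g (F \o gamma) + L').
  exact: (joined_arc (gamma := F \o gamma)).
rewrite mulrDr lerD//; apply: arc_length_le => // t t01.
have [I [oI sI CI]] := C1_arc_elim Cg.
have Ct : C1_curve_at (A := A) gamma t by apply/CI/sI; rewrite /= in_itv.
have [ct tr] := conf t t01.
have [c't h] := contr _ tr; rewrite chart_K// in c't h.
have CFt : C1_curve_at (A := A) (F \o gamma) t by apply: C1_into_comp.
rewrite /speed (chart_norm_speed g Ct Ac ct) (chart_norm_speed g CFt Ac' c't).
have Ch : C1_at (c' \o F \o chart_inv c) (c (gamma t)).
  by apply: (CF.2 c _ Ac (codom_chart ct)).2 => //=; rewrite chart_K.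
have E : 'd ((c' \o (F \o gamma)) : R^o -> 'rV[R]_d) t 1 =
    'd (c' \o F \o chart_inv c) (c (gamma t))
      ('d ((c \o gamma) : R^o -> 'rV[R]_d) t 1).
  apply: (near_eq_diff_comp (f := (c \o gamma) : R^o -> 'rV[R]_d)).
  - have nd : \forall s \near t, chart_dom c (gamma s) := Ct.1 _ (near_dom ct).
    by apply: filterS nd => s /= cs; rewrite chart_K.
  - exact: C1_at_diff (Ct.2 c Ac ct).
  - exact: C1_at_diff Ch.
exact: (eq_ind_r (fun w => chart_norm g c' (c' (F (gamma t))) w <=
  k * chart_norm g c (c (gamma t))
    ('d ((c \o gamma) : R^o -> 'rV[R]_d) t 1)) (h _) E).
Qed.

(** The curve is the straight segment in the chart, which stays in the ball by
    convexity; its velocity in the chart is constant. *)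
Lemma joined_segment c y0 r C p q : tame_ball g c y0 r C ->
  chart_ball c y0 r p -> chart_ball c y0 r q ->
  exists2 L, joined g p q L & L <= C * `|c q - c p|.
Proof.
move=> [Ac r0 C0 tmh] [cp pr] [cq qr].
pose a (t : R^o) : 'rV[R]_d := c p + t *: (c q - c p).
pose I : set R := [set t | `|a t - y0| < r].
have da t : is_diff t a ( *:%R ^~ (c q - c p)).
  have := is_diffD (is_diff_cst (c p) t) (is_diff_scalel t (c q - c p)).
  by rewrite add0r.
have Ca t : C1_at a t.
  split; first by apply: (@filterE _ (nbhs t)) => s; have [] := da s.
  move=> v; have -> : (fun s => 'd a s v) = (fun=> v *: (c q - c p)).
    by apply/funext => s; rewrite diff_val.
  exact: cvg_cst.
pose gamma : R -> M := chart_inv c \o a.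
have Cg t : I t -> C1_curve_at (A := A) gamma t.
  move=> It; have [cy _] := tmh _ It.
  have at0 : a @ t --> a t := C1_at_cont (Ca t).
  have ct : chart_dom c (gamma t) by exact: chart_inv_dom.
  apply: (@C1_into_one_chart _ _ _ _ _ gamma t c) => //.
    exact: (cvg_comp _ _ at0 (chart_inv_cvg cy)).
  apply: C1_at_ext (Ca t).
  have nd : \forall s \near t, chart_codom c (a s) := at0 _ (near_codom cy).
  by apply: filterS nd => s cs /=; rewrite chart_invK.
have oI : open I.
  rewrite openE => t It; have at0 : a @ t --> a t := C1_at_cont (Ca t).
  have dist0 := @dist_continuous _ 'rV[R]_d y0 (a t).
  exact: (cvg_comp _ _ at0 dist0 _ (lt_nbhsl It)).
have sI : `[0, 1] `<=` I.
  move=> t /=; rewrite in_itv /= => /andP[t0 t1]; rewrite /I /=.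
  have -> : a t - y0 = (1 - t) *: (c p - y0) + t *: (c q - y0).
    by apply/rowP => i; rewrite /a !mxE; ring.
  apply: le_lt_trans (ler_normD _ _) _; rewrite !normrZ ger0_norm ?subr_ge0//.
  rewrite ger0_norm//.
  have pos : 0 < (1 - t) * (r - `|c p - y0|) + t * (r - `|c q - y0|).
    have [->|t1'] := eqVneq t 1.
      by rewrite subrr mul0r add0r mul1r subr_gt0.
    rewrite ltr_wpDr ?mulr_ge0 ?mulr_gt0 ?subr_gt0 ?subr_ge0 ?(ltW qr) //.
    by rewrite lt_neqAle t1'.
  lra.
have arcg : C1_arc (A := A) gamma := C1_arc_intro oI sI Cg.
have g0 : gamma 0 = p by rewrite /gamma /a /= scale0r addr0 chart_K.
have g1 : gamma 1 = q by rewrite /gamma /a /= scale1r addrC subrK chart_K.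
exists (arc_length g gamma + 0).
  rewrite -{1}g0; apply: joined_arc => //; rewrite g1; exact: joined_refl.
rewrite addr0 arc_lengthE.
apply: (@le_trans _ _
  (\int[lebesgue_measure]_(t in `[0, 1]) (C * `|c q - c p|))).
  apply: le_Rintegral => //.
  - by apply: integrable_within; exact: speed_continuous.
  - by apply: integrable_within => t; exact: cvg_cst.
  move=> t t01; have It := sI _ t01; have [cy bd] := tmh _ It.
  have ct : chart_dom c (gamma t) by exact: chart_inv_dom.
  rewrite /speed (chart_norm_speed g (Cg _ It) Ac ct) chart_invK //.
  have E : 'd ((c \o gamma) : R^o -> 'rV[R]_d) t 1 = c q - c p.
    have at0 : a @ t --> a t := C1_at_cont (Ca t).
    have nd : \forall s \near t, a s = (c \o gamma) s.
      have nd : \forall s \near t, chart_codom c (a s) := at0 _ (near_codom cy).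
      by apply: filterS nd => s cs /=; rewrite chart_invK.
    by rewrite (near_eq_diff nd (C1_at_diff (Ca t))).2 diff_val scale1r.
  exact: (eq_ind_r (fun w => chart_norm g c (a t) w <= C * `|c q - c p|)
    (bd _).1 E).
have m1 : lebesgue_measure (`[0, 1]%classic : set R) = 1%E.
  by rewrite lebesgue_measure_itv /= lte01 oppr0 adde0.
rewrite Rintegral_cst//.
by rewrite [X in fine X]m1 mulr1.
Qed.
End confinement.

(** * Short curves near a point, and local Lipschitz estimates *)

Section local_geometry.
Context {R : realType} {d : nat} {M : topologicalType}.
Context {A : smooth_structure R d M} (g : riemannian_metric A).
Context (hM : hausdorff_space M).
Implicit Types (x y z : M) (F G : M -> M) (k l L : R) (u v : 'rV[R]_d).

(** Nearby points have nearby coordinates, and a segment in a chart is at most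
    a constant times longer than its coordinate length. *)
Lemma near_joined x e : 0 < e ->
  exists2 W, nbhs x W &
    forall p q, W p -> W q -> exists2 L, joined g p q L & L < e.
Proof.
move=> e0; set c := chart_at A x.
have Ac : atlas A c := chart_at_atlas A x.
have cx : chart_dom c x := chart_at_dom A x.
have [r [C [tm _]]] := tame_ball_exists g Ac cx filterT.
have [_ r0 C0 tmh] := tm.
(* Two points at coordinate distance less than s from the centre are joined by
   a segment of length less than C * (2 * s). *)
pose s := Num.min r (e / (2 * C)).
have s0 : 0 < s by rewrite lt_min r0 divr_gt0// mulr_gt0.
have sr : s <= r by rewrite ge_min lexx.
have sub p : chart_ball c (c x) s p -> chart_ball c (c x) r p.
  by move=> [cp ps]; split=> //; exact: lt_le_trans sr.
exists (chart_ball c (c x) s).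
  by apply: near_chart_ball; split=> //; rewrite subrr normr0.
move=> p q Wp Wq; have [L jL LC] := joined_segment tm (sub p Wp) (sub q Wq).
exists L => //; apply: le_lt_trans LC _.
have se : s <= e / (2 * C) by rewrite ge_min lexx orbT.
have : `|c q - c p| < 2 * s.
  rewrite -[c q](subrK (c x)) -addrA (le_lt_trans (ler_normD _ _))//.
  by rewrite mulrDl mul1r ltrD ?Wq.2// distrC Wp.2.
rewrite -(ltr_pM2l C0) => /lt_le_trans; apply.
by move: se; rewrite ler_pdivlMr ?mulr_gt0// => se; lra.
Qed.

(** A short curve that starts well inside a chart ball does not leave it, so
    small metric balls around x are contained in U. *)
Lemma joined_near x (U : set M) : nbhs x U ->
  exists W rho, [/\ nbhs x W, 0 < rho & forall y z L, W y -> joined g y z L ->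
    L < rho -> U z].
Proof.
move=> xU; set c := chart_at A x.
have Ac : atlas A c := chart_at_atlas A x.
have cx : chart_dom c x := chart_at_dom A x.
have YU : nbhs (c x) (chart_inv c @^-1` U).
  by apply: (chart_inv_cvg (codom_chart cx)); rewrite chart_K.
have [r [C [tm hY]]] := tame_ball_exists g Ac cx YU.
have [_ r0 C0 tmh] := tm.
(* Half of the radius is left for the curve, whose coordinates move by at most
   C * L. *)
exists (chart_ball c (c x) (r / 2)), (r / (2 * C)); split.
- by apply: near_chart_ball; split=> //; rewrite subrr normr0 divr_gt0.
- by rewrite divr_gt0// mulr_gt0.
move=> y z L [cy yr] jL.
rewrite ltr_pdivlMr ?mulr_gt0// => LC.
have lr : `|c y - c x| + C * L < r by lra.
have [cz zL] := joined_confined hM tm jL cy lr.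
have : U (chart_inv c (c z)); last by rewrite chart_K.
apply: hY; rewrite -[c z](subrK (c y)) -addrA.
by rewrite (le_lt_trans (ler_normD _ _))//; lra.
Qed.

(** A curve from x that is too short stays in the complement of y. *)
Lemma joined_neq x y : x <> y ->
  exists2 eta, 0 < eta & forall L, joined g x y L -> eta <= L.
Proof.
move=> xy; have xU : nbhs x (~` [set y]).
  apply: open_nbhs_nbhs; split=> //; apply: closed_openC.
  exact/accessible_closed_set1/hausdorff_accessible.
have [W [rho [xW rho0 h]]] := joined_near xU.
exists rho => // L jL; rewrite leNgt; apply/negP => Lr.
exact: (h x y L (nbhs_singleton xW) jL Lr).
Qed.

Lemma dist_gt0 x y L : joined g x y L -> x <> y -> 0 < dist g x y.
Proof.
move=> jL /joined_neq[eta eta0 h]; apply: lt_le_trans eta0 _.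
by apply: lb_le_inf; [exists L|move=> l /h].
Qed.

Lemma dist_le x y L : joined g x y L -> dist g x y <= L.
Proof. by move=> jL; apply: ge_inf => //; exists 0 => l /joined_ge0. Qed.

(** A Lipschitz condition near x on the lengths of connecting curves instead of
    distances: it can be composed without choosing almost minimal curves. *)
Definition lip_at (F : M -> M) (k : R) (x : M) : Prop :=
  exists U rho, [/\ nbhs x U, 0 < rho & forall y z L, U y -> joined g y z L ->
    L < rho -> exists2 L', joined g (F y) (F z) L' & L' <= k * L].

Lemma lip_at_near F k x : lip_at F k x -> \forall y \near x, lip_at F k y.
Proof.
move=> [U [rho [xU rho0 h]]]; near=> y; exists U, rho; split=> //.
near: y; exact: nbhs_interior.
Unshelve. all: by end_near. Qed.

Lemma lip_at_le F k k' x : k <= k' -> lip_at F k x -> lip_at F k' x.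
Proof.
move=> kk [U [rho [xU rho0 h]]]; exists U, rho; split=> // y z L Uy jL Lr.
have [L' jL' L'k] := h y z L Uy jL Lr; exists L' => //.
by apply: le_trans L'k _; rewrite ler_wpM2r// (joined_ge0 jL).
Qed.

Lemma lip_at_id x : lip_at id 1 x.
Proof.
exists setT, 1; split=> //; first exact: filterT.
by move=> y z L _ jL _; exists L => //; rewrite mul1r.
Qed.

Lemma lip_at_comp F G k l x : continuous F -> 0 <= k -> 0 <= l ->
  lip_at F k x -> lip_at G l (F x) -> lip_at (G \o F) (l * k) x.
Proof.
move=> cF k0 l0 [U [rho [xU rho0 h]]] [U' [rho' [xU' rho'0 h']]].
(* The image curve has length at most k * L; dividing by k + 1 rather than k
   allows k = 0. *)
exists (U `&` F @^-1` U'), (Num.min rho (rho' / (k + 1))); split.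
- by apply: filterI => //; exact: (cF x _ xU').
- by rewrite lt_min rho0 divr_gt0// ltr_wpDl.
move=> y z L [Uy Uy'] jL; rewrite lt_min => /andP[Lr].
rewrite ltr_pdivlMr ?ltr_wpDl// => Lr'.
have L0 := joined_ge0 jL.
have [L1 jL1 L1k] := h y z L Uy jL Lr.
have L1r : L1 < rho' by apply: le_lt_trans Lr'; apply: le_trans L1k _; lra.
have [L2 jL2 L2k] := h' _ _ _ Uy' jL1 L1r.
exists L2 => //; apply: le_trans L2k _.
by rewrite -mulrA ler_wpM2l.
Qed.

Lemma lip_at_iter F k n x : continuous F -> 0 <= k ->
  (forall i, lip_at F k (iter i F x)) -> lip_at (iter n F) (k ^+ n) x.
Proof.
move=> cF k0 h; elim: n => [|n IH]; first exact: lip_at_id.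
have -> : iter n.+1 F = F \o iter n F by [].
rewrite exprS; apply: lip_at_comp => //; last exact: exprn_ge0.
elim: n {IH} => [|n IH]; first by move=> y; exact: cvg_id.
move=> y; apply: (@continuous_comp _ _ _ (iter n F) F); first exact: IH.
exact: cF.
Qed.

Lemma chart_norm_center x u :
  chart_norm g (chart_at A x) (chart_at A x x) u = tnorm g x u.
Proof.
have cx := chart_at_dom A x.
rewrite /chart_norm chart_K//; congr (tnorm g x _).
apply: near_id_diff; have := near_codom (codom_chart cx).
by apply: filterS => y cy /=; rewrite chart_invK.
Qed.

(** The supremum of an unbounded set is 0 by convention, so [opnorm] bounds the
    tangent map only because of this lemma. *)
Lemma tangent_bounded F x : C1_self A F ->
  has_ubound [set tnorm g (F x) (tangent_map A F x v) | v in
        [set v | tnorm g x v <= 1]].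
Proof.
move=> CF.
have cx := chart_at_dom A x; have Ac := chart_at_atlas A x.
have cFx := chart_at_dom A (F x); have AcF := chart_at_atlas A (F x).
have [C C0 /nbhs_singleton HC] := chart_norm_bounds g Ac (codom_chart cx).
have [C' C'0 /nbhs_singleton HC'] := chart_norm_bounds g AcF (codom_chart cFx).
have dF : differentiable
    (chart_at A (F x) \o F \o chart_inv (chart_at A x)) (chart_at A x x).
  apply: C1_at_diff; apply: (CF.2 _ _ Ac (codom_chart cx)).2 => //=.
  by rewrite chart_K.
have [k k0 hk] := linear_lipschitz (diff_continuous dF).
exists (C' * (k * C)) => _ [v /= v1 <-].
rewrite -chart_norm_center; apply: le_trans (HC' _).1 _.
rewrite ler_pM2l//; apply: le_trans (hk v) _; rewrite ler_pM2l//.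
apply: le_trans (HC v).2 _; rewrite chart_norm_center.
by rewrite ler_piMr// ltW.
Qed.

(** The ratio of the norms of the image vector and of the vector is a continuous
    function of the base point and of the direction; as it is less than k for
    all directions at x, it is less than k for all directions near x. *)
Lemma lip_at_opnorm F x k : C1_self A F -> opnorm g F x < k -> lip_at F k x.
Proof.
move=> CF Fk; have bd := tangent_bounded x CF.
have Fmax v : tnorm g x v <= 1 ->
    tnorm g (F x) (tangent_map A F x v) <= opnorm g F x.
  by move=> v1; apply: ub_le_sup => //; exists v.
have k0 : 0 <= k.
  apply: le_trans (ltW Fk).
  apply: (le_trans (tnorm_ge0 g (F x) (tangent_map A F x 0))); apply: Fmax.
  by rewrite -chart_norm_center chart_norm0 ler01.
set c := chart_at A x; set c' := chart_at A (F x).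
have cx : chart_dom c x := chart_at_dom A x.
have Ac : atlas A c := chart_at_atlas A x.
have cFx : chart_dom c' (F x) := chart_at_dom A (F x).
have AcF : atlas A c' := chart_at_atlas A (F x).
have CFx : C1_at (c' \o F \o chart_inv c) (c x).
  apply: (CF.2 _ _ Ac (codom_chart cx)).2 => //=.
  by rewrite chart_K.
pose N (y u : 'rV[R]_d) := chart_norm g c' (c' (F (chart_inv c y)))
  ('d (c' \o F \o chart_inv c) y u).
pose Phi (y u : 'rV[R]_d) : R := N y u - k * chart_norm g c y u.
have cPhi (u : 'rV[R]_d) : Phi p.1 p.2 @[p --> (c x, u)] --> Phi (c x) u.
  apply: cvgB; last first.
    by apply: cvgMr; apply: chart_norm_cvg => //; exact: codom_chart.
  have c1 : (fun p : 'rV[R]_d * 'rV[R]_d => c' (F (chart_inv c p.1)))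
      @ (c x, u) --> c' (F (chart_inv c (c x))).
    apply: (@cvg_comp _ _ _ (fun p : 'rV[R]_d * 'rV[R]_d => p.1)
      (c' \o F \o chart_inv c) _ (nbhs (c x))); first exact: cvg_fst.
    exact: C1_at_cont CFx.
  have c2 : 'd (c' \o F \o chart_inv c) (p.1) p.2 @[p --> (c x, u)] -->
      'd (c' \o F \o chart_inv c) (c x) u by exact: C1_at_diff_joint.
  rewrite /N; rewrite chart_K// in c1 *.
  apply: (@cvg_comp _ _ _
    (fun p : 'rV[R]_d * 'rV[R]_d =>
      (c' (F (chart_inv c p.1)), 'd (c' \o F \o chart_inv c) (p.1) p.2))
    (fun p : 'rV[R]_d * 'rV[R]_d => chart_norm g c' p.1 p.2) _
    (nbhs (c' (F x), 'd (c' \o F \o chart_inv c) (c x) u))).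
    exact: cvg_pair c1 c2.
  by apply: chart_norm_cvg => //; exact: codom_chart.
have Phi0 (u : 'rV[R]_d) : sphere u -> Phi (c x) u < 0.
  move=> Su; rewrite /Phi subr_lt0 /N chart_K// !chart_norm_center.
  have u0 : 0 < tnorm g x u.
    rewrite -chart_norm_center.
    apply: chart_norm_gt0 => //; first exact: codom_chart.
    by apply: contra_eq_neq Su => ->; rewrite normr0 eq_sym oner_neq0.
  have := Fmax ((tnorm g x u)^-1 *: u).
  rewrite tnormZ gtr0_norm ?invr_gt0// mulVf ?gt_eqF// lexx => /(_ isT).
  rewrite /tangent_map linearZ tnormZ gtr0_norm ?invr_gt0//.
  rewrite ler_pdivrMl// mulrC => /le_lt_trans; apply.
  by rewrite ltr_pM2r.
have Nr := sphere_near (fun u _ => cPhi u) Phi0.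
have ND : \forall y \near c x, chart_dom c' (F (chart_inv c y)).
  have cc : (F \o chart_inv c) @ (c x) --> F x.
    have := chart_inv_cvg (codom_chart cx); rewrite chart_K// => cc.
    exact: (cvg_comp _ _ cc (CF.1 x)).
  exact: (cc _ (near_dom cFx)).
have [r [C [tm hY]]] := tame_ball_exists g Ac cx (filterI Nr ND).
have [_ r0 C0 tmh] := tm.
exists (chart_ball c (c x) (r / 2)), (r / (2 * C)); split.
- by apply: near_chart_ball; split=> //; rewrite subrr normr0 divr_gt0.
- by rewrite divr_gt0// mulr_gt0.
move=> y z L [cy yr] jL.
rewrite ltr_pdivlMr ?mulr_gt0// => LC.
have lr : `|c y - c x| + C * L < r by lra.
apply: (joined_image hM tm k0 CF AcF _ jL cy lr).
move=> w /hY[hw dw]; split=> // u.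
have [->|u0] := eqVneq u 0.
  by rewrite linear0 !chart_norm0 mulr0.
have := hw _ (rV_normalize u0).
rewrite /Phi /N linearZ !chart_normZ normfV normr_id subr_lt0 mulrCA.
by rewrite ltr_pM2l ?invr_gt0 ?normr_gt0// => /ltW.
Qed.
End local_geometry.

(** * Compactness, finiteness and periodicity *)

(** The local hypothesis holds for all n beyond its threshold, so finitely many
    neighbourhoods that cover K can share the largest of their thresholds. *)
Lemma compact_uniform (T : topologicalType) (K : set T) (P : nat -> T -> Prop) :
  compact K ->
  (forall x, K x ->
    exists m, \forall y \near x, forall n, (m <= n)%N -> P n y) ->
  exists m, forall y, K y -> P m y.
Proof.
move=> /compact_near_coveringP cov loc.
have [m _ /(_ m (leqnn m)) Pm] : \forall m \near \oo, K `<=` P m.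
  apply: cov => x /loc[m xm].
  exists ([set y | forall n, (m <= n)%N -> P n y], [set n | (m <= n)%N]) => /=.
    by split=> //; exact: nbhs_infty_ge.
  by move=> [y n] /= [h mn]; exact: h.
by exists m.
Qed.

Lemma expr_near0 (R : realType) (z e : R) : 0 <= z < 1 -> 0 < e ->
  \forall n \near \oo, z ^+ n < e.
Proof.
move=> /andP[z0 z1] e0; apply: (@cvgr_lt _ _ _ _ (GRing.exp z) 0) => //.
by apply: cvg_expr; rewrite ger0_norm.
Qed.

(** Choose for every n a preimage of p under the n-th iterate.  Two of these
    points of the finite set coincide, say for i < j, and then the iterate of
    order j - i fixes p. *)
Lemma exists_periodic (T : Type) (K : set T) (f : T -> T) p :
  finite_set K -> f @` K = K -> K p ->
  exists2 n, (0 < n)%N & iter n f p = p.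
Proof.
move=> Kfin fK Kp.
have pre n : exists q, K q /\ iter n f q = p.
  elim: n => [|n [q [Kq <-]]]; first by exists p.
  move: Kq; rewrite -{1}fK => -[r Kr <-].
  by exists r; split=> //; rewrite iterSr.
have [h hP] := choice pre.
apply: contrapT => noper.
apply: infinite_nat; suff -> : [set: nat] = h @^-1` K.
  apply: finite_preimage => // i j _ _ hij; apply: contrapT => ij.
  wlog lij : i j hij ij / (i < j)%N.
    by move=> H; have [/H|/H|] := ltngtP i j; first exact; auto.
  apply: noper; exists (j - i)%N; first by rewrite subn_gt0.
  rewrite -{1}(hP i).2 -iterD subnK ?(ltnW lij)// hij.
  exact: (hP j).2.
by apply/seteqP; split=> // n _; exact: (hP n).1.
Qed.

Lemma iter_stable (T : Type) (K : set T) (f : T -> T) n x :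
  f @` K = K -> K x -> K (iter n f x).
Proof.
move=> fK Kx; elim: n => //= n IH; rewrite -fK; exact: imageP.
Qed.

Lemma iter_image (T : Type) (K : set T) (f : T -> T) n :
  f @` K = K -> iter n f @` K = K.
Proof.
move=> fK; elim: n => [|n IH]; first exact: image_id.
by rewrite -[RHS]fK -[in RHS]IH image_comp.
Qed.

(** Finitely many small sets cover K; take for B more points than there are
    sets in this cover.  The choice of B precedes that of h, so that h may depend
    on B and, in particular, on how well separated its points are. *)
Lemma cover_pigeonhole (M : topologicalType) (K : set M)
    (small : set M -> Prop) : compact K -> infinite_set K ->
  (forall x, K x -> exists2 W, nbhs x W & small W) ->
  exists B : {fset M}, [set` B] `<=` K /\
    forall h : M -> M, (forall b, K b -> K (h b)) ->
    exists b b' W,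
      [/\ b \in B, b' \in B, b <> b', small W & W (h b) /\ W (h b')].
Proof.
move=> cK Kinf loc.
have [x0 Kx0] : K !=set0.
  by apply/set0P; apply: contra_not_neq Kinf => ->; exact: finite_set0.
(* [compact_cover] is about pointed spaces; a point of K serves as the
   distinguished point. *)
pose M' : ptopologicalType :=
  HB.pack (M : Type) (isPointed.Build M x0) (Topological.class M).
have : @compact M' K := cK.
rewrite compact_cover => /(_ (set M) small (@interior M)) [].
- by move=> W _; exact: open_interior.
- by move=> x /loc[W xW sW]; exists W.
move=> D' D'small KD'.
have [B BK sB] := infinite_set_fset (#|` D'|)%fset.+1 Kinf.
exists B; split=> // h hK.
have loch (b : B) : exists W : D', (val W)^° (h (val b)).
  have [W /= WD' hW] := KD' _ (hK _ (BK _ (valP b))).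
  by exists [` WD']%fset.
have [w hw] := choice loch.
apply: contrapT => nopair.
suff /leq_card : injective w by rewrite -!cardfE leqNgt sB.
move=> b b' wb; apply: contrapT => bb'; apply: nopair.
exists (val b), (val b'), (val (w b)); split; [exact: valP..| | |].
- by move=> /val_inj.
- exact: set_mem (D'small _ (valP (w b))).
- by split; apply: interior_subset; [|rewrite wb]; exact: hw.
Qed.

(** * Contracting iterates on an invariant compact set *)

Section dynamics.
Context {R : realType} {d : nat} {M : topologicalType}.
Context {A : smooth_structure R d M} (g : riemannian_metric A).
Context (hM : hausdorff_space M).
Implicit Types (x y z : M) (F G f : M -> M) (k l L : R) (K : set M).

(** If no positive iterate had norm less than 1, all terms of the sequence,
    including the term 0 of index 0, would be nonnegative. *)
Lemma chi_minus_lt0 f x : (chi_minus g f x < 0)%E ->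
  exists2 n, (0 < n)%N & opnorm g (iter n f) x < 1.
Proof.
move=> chi; apply: contrapT => no; move: chi; apply/negP; rewrite -leNgt.
rewrite /chi_minus limn_einf_lim; apply: lime_ge; first exact: is_cvg_einfs.
apply: nearW => n; apply: le_ereal_inf_tmp => _ [m /= nm <-].
case: m {nm} => [|m]; first by rewrite invr0 mul0e.
have ln0 : (0 <= lne (opnorm g (iter m.+1 f) x)%:E)%E.
  by rewrite lne_ge0 lee_fin leNgt; apply/negP => lt1; apply: no; exists m.+1.
by apply: mule_ge0 ln0; rewrite lee_fin.
Qed.

(** Around each point of K some iterate contracts.  By compactness the number
    of iterates and the contraction factor are uniform, and an orbit can be cut
    into such contracting blocks. *)
Lemma uniform_contraction f K : C1_self A f -> compact K -> f @` K = K ->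
  (forall x, K x -> exists2 n, (0 < n)%N & opnorm g (iter n f) x < 1) ->
  exists2 N, (0 < N)%N & forall y, K y -> lip_at g (iter N f) 2^-1 y.
Proof.
move=> Cf cK fK contr.
(* A single integer m bounds at once the number of iterates, the distance of
   the contraction factor to 1, and the Lipschitz constant of f. *)
pose P m y :=
  (exists2 n, (0 < n <= m)%N & lip_at g (iter n f) (1 - m.+1%:R^-1) y) /\
  lip_at g f m.+1%:R y.
have [m Pm] : exists m, forall y, K y -> P m y.
  apply: compact_uniform => // x Kx.
  have [n n0 nx] := contr x Kx.
  pose a := (1 + opnorm g (iter n f) x) / 2.
  have a1 : a < 1 by rewrite /a; lra.
  have na : \forall y \near x, lip_at g (iter n f) a y.
    apply: lip_at_near; apply: lip_at_opnorm => //; first exact: C1_self_iter.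
    by rewrite /a; lra.
  pose b := opnorm g f x + 1.
  have nb : \forall y \near x, lip_at g f b y.
    by apply: lip_at_near; apply: lip_at_opnorm => //; rewrite ltrDl.
  have [m1 _ hm1] : \forall m \near \oo, (1 - a)^-1 < m%:R.
    exact: nbhs_infty_gtr.
  have [m2 _ hm2] : \forall m \near \oo, b < m%:R by exact: nbhs_infty_gtr.
  exists (maxn n (maxn m1 m2)); apply: filterS2 na nb => y ya yb i.
  rewrite !geq_max => /and3P[ni m1i m2i]; split.
    exists n; first by rewrite n0.
    apply: lip_at_le ya; rewrite lerBrDr -lerBrDl ltW//.
    rewrite -[ltRHS]invrK ltf_pV2 ?posrE ?invr_gt0 ?subr_gt0//.
    by apply: hm1 => /=; exact: leqW.
  by apply: lip_at_le yb; apply/ltW/hm2 => /=; exact: leqW.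
pose a : R := 1 - m.+1%:R^-1; pose b : R := m.+1%:R.
have a0 : 0 <= a by rewrite subr_ge0 invf_le1// ler1n.
have a1 : a < 1 by rewrite ltrBlDr ltrDl.
have b1 : 1 <= b by rewrite ler1n.
have cf := Cf.1.
pose C := b ^+ m.
have C1 : 1 <= C by exact: exprn_ege1.
have C0 : 0 <= C by exact: le_trans C1.
have short n y : K y -> (n <= m)%N -> lip_at g (iter n f) C y.
  move=> Ky nm; apply: (@lip_at_le _ _ _ _ _ _ (b ^+ n)).
    exact: ler_weXn2l.
  apply: lip_at_iter => //.
  by move=> i; apply: (Pm _ _).2; exact: iter_stable.
(* The n iterates are cut into blocks of length at most m, each of which
   contracts by a except possibly the last one, whose expansion is at most C;
   hence at least j contracting blocks once n is at least j * m. *)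
have key n : forall j y, K y -> (j * m <= n)%N ->
    lip_at g (iter n f) (C * a ^+ j) y.
  have [i] := ubnP n; elim: i n => // i IH n; rewrite ltnS => ni j y Ky jn.
  have [[s /andP[s0 sm] ly] _] := Pm y Ky.
  have [ns|sn] := ltnP n s.
    have nm : (n < m)%N by exact: leq_trans sm.
    have -> : j = 0%N by case: j jn => // j jn; lia.
    by rewrite expr0 mulr1; apply: short => //; exact: ltnW.
  have E : iter n f = iter (n - s) f \o iter s f.
    by apply/funext => w /=; rewrite -iterD subnK.
  have Ks : K (iter s f y) by exact: iter_stable.
  have step : lip_at g (iter n f) (C * a ^+ j.-1 * a) y.
    rewrite E; apply: lip_at_comp => //.
    - exact: (C1_self_iter s Cf).1.
    - by rewrite mulr_ge0 ?exprn_ge0.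
    - apply: IH => //; first by lia.
      by case: j jn => // j jn /=; lia.
  apply: lip_at_le step; rewrite -mulrA ler_wpM2l//.
  by case: j jn => [|j] jn; rewrite /= ?expr0 ?mul1r ?exprSr// ltW.
have [j _ hj] : \forall j \near \oo, a ^+ j < 2^-1 / C.
  by apply: expr_near0; [rewrite a0|rewrite divr_gt0// (lt_le_trans ltr01)].
(* The successor makes N positive even when j or m vanishes. *)
exists (j * m).+1 => // y Ky.
apply: (@lip_at_le _ _ _ _ _ _ (C * a ^+ j)).
  by rewrite mulrC -ler_pdivlMr ?(lt_le_trans ltr01)//; apply/ltW/hj => /=.
by apply: key.
Qed.

(** By compactness one radius rho suits all points of K, so that along K the
    n-th iterate divides the length of curves shorter than rho by 2 ^ n.  Suppose
    that K is infinite and pull back by this iterate, which maps K onto itself,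
    more points of K than there are sets of diameter less than rho in a cover.
    Two of the pulled back points are closer than rho, so two of the given points
    are closer than rho / 2 ^ n, which is false when n is large enough. *)
Lemma finite_of_contraction F K : compact K -> F @` K = K ->
  (forall y, K y -> lip_at g F 2^-1 y) -> finite_set K.
Proof.
move=> cK FK lF.
pose P (m : nat) y := forall z L, joined g y z L -> L < m.+1%:R^-1 ->
  exists2 L', joined g (F y) (F z) L' & L' <= 2^-1 * L.
have [m Pm] : exists m, forall y, K y -> P m y.
  apply: compact_uniform => // x /lF[U [rho [xU rho0 h]]].
  have [n _ hn] : \forall n \near \oo, rho^-1 < n%:R by exact: nbhs_infty_gtr.
  exists n; apply: filterS xU => y Uy i ni z L jL Li; apply: h => //.
  apply: lt_trans Li _; rewrite -[ltRHS]invrK ltf_pV2 ?posrE ?invr_gt0//.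
  by apply: hn => /=; exact: leqW.
pose rho : R := m.+1%:R^-1; have rho0 : 0 < rho by rewrite invr_gt0.
have contr n y z L : K y -> joined g y z L -> L < rho ->
    exists2 L', joined g (iter n F y) (iter n F z) L' & L' <= 2^-1 ^+ n * L.
  move=> Ky jL Lr; elim: n => [|n [L' jL' L'n]].
    by exists L => //; rewrite mul1r.
  have L0 := joined_ge0 jL.
  have [|L2 jL2 L2n] := Pm _ (iter_stable n FK Ky) _ _ jL'.
    apply: le_lt_trans L'n _; apply: le_lt_trans Lr.
    by rewrite ler_piMl// exprn_ile1 ?invr_ge0// invf_le1// ler1n.
  exists L2 => //; apply: le_trans L2n _.
  by rewrite exprS -mulrA ler_wpM2l.
apply: contrapT => Kinf.
pose small (W : set M) :=
  forall p q, W p -> W q -> exists2 L, joined g p q L & L < rho.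
have [B [BK pig]] := @cover_pigeonhole M K small cK Kinf
  (fun x _ => near_joined g x rho0).
have sep (b b' : B) : \forall n \near \oo, val b <> val b' ->
    forall L, joined g (val b) (val b') L -> 2^-1 ^+ n * rho <= L.
  have [->|/eqP bb'] := eqVneq b b'; first by apply: nearW.
  have /(joined_neq g hM)[eta eta0 heta] : val b <> val b' by move=> /val_inj.
  have : \forall n \near \oo, (2^-1 : R) ^+ n < eta / rho.
    apply: expr_near0; last by rewrite divr_gt0.
    by rewrite invr_ge0 invf_lt1 // ler0n ltr1n.
  apply: filterS => n; rewrite ltr_pdivlMr// => le _ L /heta.
  exact: le_trans (ltW le).
have [n _ /(_ n (leqnn n)) hn] : \forall n \near \oo,
    forall b b' : B, val b <> val b' ->
    forall L, joined g (val b) (val b') L -> 2^-1 ^+ n * rho <= L.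
  by apply: filter_forall => b; apply: filter_forall => b'; exact: sep.
have pre b : exists a, K b -> K a /\ iter n F a = b.
  have [Kb|nKb] := pselect (K b); last by exists b.
  by move: (Kb); rewrite -{1}(iter_image n FK) => -[a Ka <-]; exists a.
have [h hP] := choice pre.
have [b [b' [W [bB b'B bb' sW [Wb Wb']]]]] := pig h (fun b Kb => (hP b Kb).1).
have [Ka ab] := hP b (BK _ bB); have [Ka' ab'] := hP b' (BK _ b'B).
have [L jL Lr] := sW _ _ Wb Wb'.
have [L' jL' L'n] := contr n _ _ _ Ka jL Lr.
rewrite ab ab' in jL'.
have := hn [` bB]%fset [` b'B]%fset bb' L' jL'; apply/negP; rewrite -ltNge.
by apply: le_lt_trans L'n _; rewrite ltr_pM2l// exprn_gt0// invr_gt0.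
Qed.

(** Take for V a small metric ball around p.  To compare distances between two
    of its points q and r, choose a curve from q to r whose length exceeds the
    distance by a factor less than l / k: its image is shorter than l times the
    distance.  Strictness uses that distinct points are at positive distance. *)
Lemma sink_neighbourhood F k p : 0 < k < 1 -> F p = p -> lip_at g F k p ->
  exists2 V, nbhs p V & F @` V `<=` V /\
    exists l, [/\ 0 < l, l < 1 & forall q r, V q -> V r -> q <> r ->
      dist g (F q) (F r) < l * dist g q r].
Proof.
move=> /andP[k0 k1] Fp [U [rho [pU rho0 h]]].
have [W1 pW1 hW1] := near_joined g p rho0.
have [W2 [rho2 [pW2 rho20 hW2]]] := joined_near g hM (filterI pU pW1).
pose s := Num.min rho rho2.
have s0 : 0 < s by rewrite lt_min rho0.
pose V := [set y | exists2 L, joined g p y L & L < s].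
have VU y : V y -> U y /\ W1 y.
  move=> [L jL Ls]; apply: (hW2 p y L (nbhs_singleton pW2) jL).
  by apply: lt_le_trans Ls _; rewrite ge_min lexx orbT.
exists V.
  have [W3 pW3 hW3] := near_joined g p s0.
  have W3p := nbhs_singleton pW3.
  by apply: filterS pW3 => y; exact: hW3.
split.
  move=> _ [y [L jL Ls] <-].
  have Lr : L < rho by apply: lt_le_trans Ls _; rewrite ge_min lexx.
  have [L' jL' L'k] := h p y L (nbhs_singleton pU) jL Lr.
  rewrite Fp in jL'; exists L' => //; apply: le_lt_trans L'k _.
  apply: le_lt_trans Ls; apply: ler_piMl (ltW k1); exact: joined_ge0 jL.
pose l := (1 + k) / 2; have kl : k < l by rewrite /l; lra.
have l1 : l < 1 by rewrite /l; lra.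
have l0 : 0 < l by exact: lt_trans kl.
exists l; split=> // q r Vq Vr qr.
have [Uq Wq] := VU q Vq; have [_ Wr] := VU r Vr.
have [L0 jL0 L0r] := hW1 q r Wq Wr.
have D0 := dist_gt0 hM jL0 qr.
have [L jL] : exists2 L, joined g q r L & L < Num.min rho (l / k * dist g q r).
  apply: inf_lt; first by exists L0.
  rewrite lt_min (le_lt_trans (dist_le jL0) L0r) /=.
  by rewrite -[ltLHS]mul1r ltr_pM2r// ltr_pdivlMr// mul1r.
rewrite lt_min => /andP[Lr]; rewrite mulrAC ltr_pdivlMr// mulrC => Lk.
have [L' jL' L'k] := h q r L Uq jL Lr.
apply: le_lt_trans (dist_le jL') _; exact: le_lt_trans Lk.
Qed.
End dynamics.

(** The period need not be minimal: a multiple of N that fixes p is a period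
    with the required contraction. *)
Lemma sink_through_point (R : realType) (d : nat) (M : topologicalType)
    (hM : hausdorff_space M) (A : smooth_structure R d M)
    (g : riemannian_metric A) (f : M -> M) (K : set M) (N : nat) (p : M) :
  C1_self A f -> f @` K = K -> finite_set K -> (0 < N)%N ->
  (forall y, K y -> lip_at g (iter N f) 2^-1 y) -> K p ->
  exists O, [/\ is_sink g f O, O p & O `<=` K].
Proof.
move=> Cf fK Kfin N0 lN Kp.
have FK := iter_image N fK.
have [n n0 per] := exists_periodic Kfin FK Kp.
have perf : iter (n * N) f p = p by rewrite iterM.
have half0 : (0 : R) <= 2^-1 by rewrite invr_ge0.
have half1 : (2^-1 : R) < 1 by rewrite invf_lt1 // ltr1n.
have lp : lip_at g (iter (n * N) f) 2^-1 p.
  apply: (@lip_at_le _ _ _ _ _ _ (2^-1 ^+ n)).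
    case: n n0 {per perf} => // n _.
    rewrite exprS; apply: ler_piMr => //; apply: exprn_ile1 => //; exact: ltW.
  have -> : iter (n * N) f = iter n (iter N f).
    by apply/funext => x; rewrite iterM.
  apply: lip_at_iter => //; first exact: (C1_self_iter N Cf).1.
  by move=> i; apply: lN; exact: iter_stable.
have half01 : 0 < (2^-1 : R) < 1 by rewrite invr_gt0 half1 andbT.
have [V pV [VV contr]] := sink_neighbourhood hM half01 perf lp.
exists [set iter i f p | i in `I_(n * N)]; split.
- exists p, (n * N)%N; split=> //; first by rewrite muln_gt0 n0.
  by exists V.
- by exists 0%N => //=; rewrite muln_gt0 n0.
- by move=> _ [i _ <-]; exact: iter_stable.
Qed.

Theorem corollary1p8 (R : realType) (d : nat) (hd : (2 <= d)%N)
    (M : topologicalType) (hM : hausdorff_space M)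
    (Mcompact : compact [set: M]) (Mconnected : connected [set: M])
    (A : smooth_structure R d M) (g : riemannian_metric A)
    (f : M -> M) (fC1 : C1_map A f)
    (Df_inf : (0 < ereal_inf [set (opnorm g f x)%:E | x in [set: M]])%E)
    (K : set M) (Kcompact : compact K) (Kinv : f @` K = K)
    (Kchi : forall x, K x -> (chi_minus g f x < 0)%E) :
  exists S : set (set M),
    [/\ finite_set S, (forall O, S O -> is_sink g f O) &
        K = \bigcup_(O in S) O].
Proof.
have Cf := C1_map_self fC1.
have contr x : K x -> exists2 n, (0 < n)%N & opnorm g (iter n f) x < 1.
  by move=> /Kchi; exact: chi_minus_lt0.
have [N N0 lN] := uniform_contraction hM Cf Kcompact Kinv contr.
have Kfin := finite_of_contraction hM Kcompact (iter_image N Kinv) lN.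
have loc p : exists O, K p -> [/\ is_sink g f O, O p & O `<=` K].
  have [Kp|nKp] := pselect (K p); last by exists set0.
  by have [orb Horb] := sink_through_point hM Cf Kinv Kfin N0 lN Kp; exists orb.
have [h hP] := choice loc.
exists (h @` K); split.
- exact: finite_image.
- by move=> _ [p /hP[? _ _] <-].
- apply/seteqP; split=> [p Kp|p [_ [q /hP[_ _ sub] <-]]]; last exact: sub.
  by exists (h p); [exists p|have [] := hP p Kp].
Qed.
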